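(* Let $\{s_k\}_{k\in\mathbb{N}_0}$ be a positive sequence, let $d\in\mathbb{N}$ and $\ell_0\in 2\mathbb{N}_0$, and let $\tilde s_k=s_{kd+\ell_0}$. Let $\sigma$ be a moment solution of $\{s_k\}$. If the moment problem for $\{\tilde s_k\}$ is indeterminate, then there exists $\phi\in N$ such that for all $\lambda\in\mathbb{C}$ with $\operatorname{Im}\lambda>0$, $$\int_{-\infty}^{\infty}\frac{x^{\ell_0}\,d\sigma(x)}{x^d-\lambda}=-\frac{\tilde A(\lambda)\phi(\lambda)-\tilde C(\lambda)}{\tilde B(\lambda)\phi(\lambda)-\tilde D(\lambda)},$$ where $\tilde A,\tilde B,\tilde C,\tilde D$ is the Nevanlinna matrix of the indeterminate moment problem for $\{\tilde s_k\}$ (when $\phi\equiv\infty$ the right-hand side is read as $-\tilde A(\lambda)/\tilde B(\lambda)$).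
   Context: A sequence of real numbers is positive if all its Hankel matrices $(s_{i+j})_{i,j=0}^n$ are positive semidefinite; a moment solution is a non-decreasing $\sigma$ on $\mathbb{R}$ with $s_k=\int x^k\,d\sigma(x)$; the problem is indeterminate if it has more than one moment solution (identifying functions whose difference is constant at its continuity points). For an indeterminate positive sequence $\{\tilde s_k\}$ with a moment solution $\tilde\sigma$, let $P_k$ be the orthonormal polynomials (positive leading coefficient) with respect to $d\tilde\sigma$, and $Q_k(z)=\int\frac{P_k(z)-P_k(x)}{z-x}\,d\tilde\sigma(x)$ the polynomials of the second kind. The Nevanlinna matrix consists of the entire functions $\tilde A(z)=z\sum_{k\ge0}Q_k(0)Q_k(z)$, $\tilde B(z)=-1+z\sum_{k\ge0}Q_k(0)P_k(z)$, $\tilde C(z)=1+z\sum_{k\ge0}P_k(0)Q_k(z)$, $\tilde D(z)=z\sum_{k\ge0}P_k(0)P_k(z)$. $N$ denotes the class of functions holomorphic in the upper half-plane with nonnegative imaginary part, together with the constant $\infty$. *)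

(* Defs.v *)
From Stdlib Require Import Reals.
Open Scope R_scope.

Record Cx : Type := mkC { Re : R ; Im : R }.
Definition RtoC (x : R) : Cx := mkC x 0.
Definition C0 : Cx := RtoC 0.
Definition C1 : Cx := RtoC 1.
Definition Cadd (z w : Cx) : Cx := mkC (Re z + Re w) (Im z + Im w).
Definition Copp (z : Cx) : Cx := mkC (- Re z) (- Im z).
Definition Csub (z w : Cx) : Cx := Cadd z (Copp w).
Definition Cmul (z w : Cx) : Cx :=
  mkC (Re z * Re w - Im z * Im w) (Re z * Im w + Im z * Re w).
Definition Cinv (z : Cx) : Cx :=
  let n := Re z * Re z + Im z * Im z in mkC (Re z / n) (- Im z / n).
Definition Cdiv (z w : Cx) : Cx := Cmul z (Cinv w).
Fixpoint Cpow (z : Cx) (n : nat) : Cx :=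
  match n with O => C1 | S n => Cmul (Cpow z n) z end.
Definition Cnorm (z : Cx) : R := sqrt (Re z * Re z + Im z * Im z).

Fixpoint rsum (n : nat) (g : nat -> R) : R :=
  match n with O => 0 | S n => rsum n g + g n end.
Fixpoint csum (n : nat) (g : nat -> Cx) : Cx :=
  match n with O => C0 | S n => Cadd (csum n g) (g n) end.

Definition RS_int (f sigma : R -> R) (a b I : R) : Prop :=
  a < b /\
  forall eps, 0 < eps -> exists delta, 0 < delta /\
    forall (n : nat) (x t : nat -> R),
      x O = a -> x n = b ->
      (forall i, (i < n)%nat ->
         x i < x (S i) /\ x (S i) - x i < delta /\ x i <= t i <= x (S i)) ->
      Rabs (rsum n (fun i => f (t i) * (sigma (x (S i)) - sigma (x i))) - I) < eps.

Definition RS_int_R (f sigma : R -> R) (I : R) : Prop :=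
  (forall a b, a < b -> exists J, RS_int f sigma a b J) /\
  forall eps, 0 < eps -> exists M, forall a b J,
    a < - M -> M < b -> RS_int f sigma a b J -> Rabs (J - I) < eps.

Definition CRS_int_R (f : R -> Cx) (sigma : R -> R) (I : Cx) : Prop :=
  RS_int_R (fun x => Re (f x)) sigma (Re I) /\
  RS_int_R (fun x => Im (f x)) sigma (Im I).

Definition nondecreasing (sigma : R -> R) : Prop :=
  forall x y, x <= y -> sigma x <= sigma y.

Definition positive_seq (s : nat -> R) : Prop :=
  forall (n : nat) (v : nat -> R),
    0 <= rsum (S n) (fun i => rsum (S n) (fun j => s (i + j)%nat * v i * v j)).

Definition moment_solution (s : nat -> R) (sigma : R -> R) : Prop :=
  nondecreasing sigma /\ forall k : nat, RS_int_R (fun x => x ^ k) sigma (s k).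

Definition same_solution (s1 s2 : R -> R) : Prop :=
  exists c, forall x, continuity_pt (fun y => s1 y - s2 y) x -> s1 x - s2 x = c.

Definition indeterminate (s : nat -> R) : Prop :=
  exists s1 s2, moment_solution s s1 /\ moment_solution s s2 /\
                ~ same_solution s1 s2.

Definition pevalR (p : nat -> R) (n : nat) (x : R) : R :=
  rsum (S n) (fun j => p j * x ^ j).
Definition pevalC (p : nat -> R) (n : nat) (z : Cx) : Cx :=
  csum (S n) (fun j => Cmul (RtoC (p j)) (Cpow z j)).
(* the polynomial (p(z) - p(x)) / (z - x) in the two variables z, x *)
Definition divdiff (p : nat -> R) (n : nat) (z : Cx) (x : R) : Cx :=
  csum (S n) (fun j => Cmul (RtoC (p j))
     (csum j (fun i => Cmul (Cpow z i) (RtoC (x ^ (j - 1 - i)))))).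

Definition orthonormal_polys (sigma : R -> R) (P : nat -> nat -> R) : Prop :=
  (forall k j, (k < j)%nat -> P k j = 0) /\
  (forall k, 0 < P k k) /\
  (forall k m, RS_int_R (fun x => pevalR (P k) k x * pevalR (P m) m x) sigma
                        (if Nat.eqb k m then 1 else 0)).

Definition second_kind (sigma : R -> R) (P : nat -> nat -> R)
  (Q : nat -> Cx -> Cx) : Prop :=
  forall k z, CRS_int_R (fun x => divdiff (P k) k z x) sigma (Q k z).

Definition Cser_cv (u : nat -> Cx) (l : Cx) : Prop :=
  Un_cv (fun n => Re (csum (S n) u)) (Re l) /\
  Un_cv (fun n => Im (csum (S n) u)) (Im l).

Definition nevanlinna_matrix (P : nat -> nat -> R) (Q : nat -> Cx -> Cx)
  (A B C D : Cx -> Cx) : Prop :=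
  forall z,
    Cser_cv (fun k => Cmul z (Cmul (Q k C0) (Q k z))) (A z) /\
    Cser_cv (fun k => Cmul z (Cmul (Q k C0) (pevalC (P k) k z))) (Cadd (B z) C1) /\
    Cser_cv (fun k => Cmul z (Cmul (RtoC (pevalR (P k) k 0)) (Q k z))) (Csub (C z) C1) /\
    Cser_cv (fun k => Cmul z (Cmul (RtoC (pevalR (P k) k 0)) (pevalC (P k) k z))) (D z).

Definition upper (z : Cx) : Prop := 0 < Im z.

Definition holomorphic_upper (f : Cx -> Cx) : Prop :=
  forall z, upper z -> exists f' : Cx, forall eps, 0 < eps -> exists delta,
    0 < delta /\ forall h : Cx, h <> C0 -> Cnorm h < delta ->
      Cnorm (Csub (Cdiv (Csub (f (Cadd z h)) (f z)) h) f') < eps.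

(* None represents the constant function infinity *)
Definition in_N (phi : option (Cx -> Cx)) : Prop :=
  match phi with
  | None => True
  | Some f => holomorphic_upper f /\ forall z, upper z -> 0 <= Im (f z)
  end.

Definition nev_transform (A B C D : Cx -> Cx) (phi : option (Cx -> Cx))
  (l : Cx) : Cx :=
  match phi with
  | None => Copp (Cdiv (A l) (B l))
  | Some f => Copp (Cdiv (Csub (Cmul (A l) (f l)) (C l))
                         (Csub (Cmul (B l) (f l)) (D l)))
  end.

(* Main.v *)
From Stdlib Require Import Reals Lra Lia Wf_nat ClassicalEpsilon FunctionalExtensionality.
Require Import Defs.
Open Scope R_scope.

(* Pulling sigma back, mu(f) = int x^l0 f(x^d) dsigma(x) is a positive functional
   with moments s~_k, and w(z) = mu(1/(t - z)) is the left-hand side.  Solving for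
   the parameter, phi = F / E with F = C + w D and E = A + w B.

   Let c_k(z) = mu(P_k(t) / (t - z)) = w P_k(z) + Q_k(z).  The Christoffel-Darboux
   formula gives, for the n-th partial sums,
     F_n(z) E_n(y) - E_n(z) F_n(y) = w(z) - w(y) - (z - y) sum_(k <= n) c_k(z) c_k(y)
                                   = (z - y) b_n(z, y),
   where b_n(z, y) = mu(g_z g_y) - sum_(k <= n) c_k(z) c_k(y), g_z = 1/(t - z), is the
   Bessel form, i.e. the inner product of the components of g_z and conj(g_y)
   orthogonal to P_0, ..., P_n.  Taking y = conj z gives Im (F conj E) >= 0.
   If Im (F conj E) vanishes at some point, the Cauchy-Schwarz inequality for b_n
   shows that F / E is a constant in R or infinity.  Otherwise E has no zero, and
   phi(z) - phi(y) = (z - y) b(z, y) / (E(z) E(y)) is complex differentiable, because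
   b(., y) and b(., conj y) are Lipschitz at y, uniformly in n; so only pointwise
   convergence of the Nevanlinna series in the upper and lower half-planes is used. *)

(** The hidden difficulty is the continuity of [E], since [w] and the entries of the Nevanlinna
    matrix enter only through their values at single points. All regularity therefore comes from the
    forms [b_n], which Bessel's inequality bounds independently of [n]. The limit [N z y] of
    [F_n(z) E_n(y) - E_n(z) F_n(y)] inherits these bounds, and [E z] is recovered from [N z y] and
    [N z (conj y)] by solving a two by two linear system. Its determinant is a multiple of
    [Im (F conj E)] at [y], which explains the case distinction. On the diagonal [z = y] the Darboux
    formula reads [0 = 0]; there [b(y, y)] is obtained from the convergence of the Bessel sums.

    The image of [x^l0 dsigma] under [x |-> x^d] is never built as a distribution function. A
    functional that is linear and positive on continuous functions of polynomial growth suffices: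
    this class contains the polynomials and both parts of every nonreal Cauchy kernel, and it is
    closed under products. On polynomials the functional agrees with integration against [sigt],
    which is all that the orthonormal system sees. *)

Lemma rsum_ext n f g :
  (forall i, (i < n)%nat -> f i = g i) -> rsum n f = rsum n g.
Proof.
  induction n as [|n IH]; intros H; simpl; [easy|].
  rewrite IH by (intros; apply H; lia). rewrite H by lia. easy.
Qed.

Lemma rsum_lin n a b f g :
  rsum n (fun i => a * f i + b * g i) = a * rsum n f + b * rsum n g.
Proof. induction n as [|n IH]; simpl; [ring|rewrite IH; ring]. Qed.

Lemma rsum_scal n a f : rsum n (fun i => a * f i) = a * rsum n f.
Proof. induction n as [|n IH]; simpl; [ring|rewrite IH; ring]. Qed.

Lemma rsum_zero n f : (forall i, (i < n)%nat -> f i = 0) -> rsum n f = 0.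
Proof.
  induction n as [|n IH]; intros H; simpl; [easy|].
  rewrite IH by (intros; apply H; lia). rewrite H by lia. ring.
Qed.

Lemma rsum_le n f g :
  (forall i, (i < n)%nat -> f i <= g i) -> rsum n f <= rsum n g.
Proof.
  induction n as [|n IH]; intros H; simpl; [lra|].
  assert (rsum n f <= rsum n g) by (apply IH; intros; apply H; lia).
  specialize (H n ltac:(lia)). lra.
Qed.

Lemma rsum_swap n m (f : nat -> nat -> R) :
  rsum n (fun i => rsum m (fun j => f i j)) =
  rsum m (fun j => rsum n (fun i => f i j)).
Proof.
  induction n as [|n IH]; simpl.
  - symmetry; apply rsum_zero; easy.
  - rewrite IH. transitivity (1 * rsum m (fun j => rsum n (fun i => f i j))
      + 1 * rsum m (fun j => f n j)); [ring|].
    rewrite <- rsum_lin. apply rsum_ext; intros; ring.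
Qed.

Lemma rsum_telescope n u : rsum n (fun i => u (S i) - u i) = u n - u O.
Proof. induction n as [|n IH]; simpl; [ring|rewrite IH; ring]. Qed.

(** * Riemann-Stieltjes sums *)

(** For [u <= v] this is the nearest point of [[u, v]]. The increment of [s] between two clamped
    points is then the mass of the overlap of two intervals, and it is 0 if they are disjoint. *)
Definition clamp (u v x : R) : R := Rmax u (Rmin v x).

Ltac unclamp := unfold clamp, Rmax, Rmin; repeat destruct Rle_dec; try lra.

(** Both sides are the [s]-mass of the overlap of [[u, v]] and [[y, y']]. The symmetry lets a double
    array of overlaps be summed along either partition. *)
Lemma clamp_mass_sym s u v y y' : u <= v -> y <= y' ->
  s (clamp u v y') - s (clamp u v y) = s (clamp y y' v) - s (clamp y y' u).
Proof.
  intros H1 H2.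
  unclamp; repeat match goal with
   | |- context [s ?a - s ?b] =>
      (replace a with b by lra; replace (s b - s b) with 0 by ring) end; try easy;
  match goal with
   | |- context [s ?a - s ?b = s ?c - s ?d] => replace c with a by lra; replace d with b by lra; easy
   | |- 0 = s ?a - s ?b => replace a with b by lra; ring
  end.
Qed.

Lemma clamp_mono u v x y : x <= y -> clamp u v x <= clamp u v y.
Proof. intros; unclamp. Qed.

Lemma clamp_mass_le s u v y y' : nondecreasing s -> u <= v -> y <= y' ->
  s (clamp u v y') - s (clamp u v y) <= s y' - s y.
Proof.
  intros Hs H1 H2. rewrite clamp_mass_sym by easy.
  assert (s (clamp y y' v) <= s y') by (apply Hs; unclamp).
  assert (s y <= s (clamp y y' u)) by (apply Hs; unclamp). lra.
Qed.

Definition tagged (a b delta : R) (n : nat) (x t : nat -> R) : Prop :=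
  x O = a /\ x n = b /\
  forall i, (i < n)%nat ->
    x i < x (S i) /\ x (S i) - x i < delta /\ x i <= t i <= x (S i).

Definition RS_sum (f sigma : R -> R) (n : nat) (x t : nat -> R) : R :=
  rsum n (fun i => f (t i) * (sigma (x (S i)) - sigma (x i))).

Lemma tagged_bounds a b delta n x t : tagged a b delta n x t ->
  forall i, (i <= n)%nat -> a <= x i <= b.
Proof.
  intros (Ha & Hb & H).
  assert (L : forall i, (i <= n)%nat -> a <= x i).
  { induction i as [|i IH]; intros Hi; [lra|].
    specialize (H i ltac:(lia)). specialize (IH ltac:(lia)). lra. }
  assert (U : forall k, (k <= n)%nat -> x (n - k)%nat <= b).
  { induction k as [|k IH]; intros Hk; [replace (n-0)%nat with n by lia; lra|].
    specialize (H (n - S k)%nat ltac:(lia)). specialize (IH ltac:(lia)).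
    replace (S (n - S k)) with (n - k)%nat in H by lia. lra. }
  intros i Hi; split; [auto|].
  replace i with (n - (n - i))%nat by lia. apply U; lia.
Qed.

(* The sigma-mass of the intersection of a cell of the first partition with a
   cell of the second one is a difference of sigma at clamped points, so that
   it telescopes along either partition: no common refinement is needed. *)
Lemma RS_sum_compare f s a b a' b' d d' n x t m y r eps :
  nondecreasing s ->
  tagged a b d n x t -> tagged a' b' d' m y r -> a' <= a -> b <= b' ->
  (forall p q, a' <= p <= b' -> a' <= q <= b' -> Rabs (p - q) < d + d' ->
     f p <= f q + eps) ->
  RS_sum f s n x t <=
  rsum m (fun j => f (r j) * (s (clamp a b (y (S j))) - s (clamp a b (y j))))
  + eps * (s b - s a).
Proof.
  intros Hs Hx Hy Ha Hb Hf.
  pose proof (tagged_bounds _ _ _ _ _ _ Hx) as Bx.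
  pose proof (tagged_bounds _ _ _ _ _ _ Hy) as By.
  destruct Hx as (Hx0 & Hxn & Hx), Hy as (Hy0 & Hyn & Hy).
  assert (Hab : a <= b) by (specialize (Bx O ltac:(lia)); lra).
  set (M := fun i j => s (clamp (x i) (x (S i)) (y (S j)))
                       - s (clamp (x i) (x (S i)) (y j))).
  assert (Row : forall i, (i < n)%nat -> rsum m (M i) = s (x (S i)) - s (x i)).
  { intros i Hi. unfold M.
    rewrite (rsum_telescope m (fun j => s (clamp (x i) (x (S i)) (y j)))).
    rewrite Hy0, Hyn. specialize (Hx i Hi).
    pose proof (Bx i ltac:(lia)). pose proof (Bx (S i) ltac:(lia)).
    f_equal; [|f_equal]; f_equal; unclamp. }
  assert (Col : forall j, (j < m)%nat -> rsum n (fun i => M i j) =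
    s (clamp a b (y (S j))) - s (clamp a b (y j))).
  { intros j Hj. specialize (Hy j Hj).
    rewrite (rsum_ext n _ (fun i => s (clamp (y j) (y (S j)) (x (S i)))
        - s (clamp (y j) (y (S j)) (x i)))).
    2:{ intros i Hi. specialize (Hx i Hi). apply clamp_mass_sym; lra. }
    rewrite (rsum_telescope n (fun i => s (clamp (y j) (y (S j)) (x i)))).
    rewrite Hx0, Hxn. symmetry; apply clamp_mass_sym; lra. }
  (* Cells that meet have tags closer than [d + d'], so [Hf] applies; cells that do not meet have an
     overlap of mass 0. *)
  assert (Cell : forall i j, (i < n)%nat -> (j < m)%nat ->
     f (t i) * M i j <= (f (r j) + eps) * M i j).
  { intros i j Hi Hj. pose proof (Hx i Hi). pose proof (Hy j Hj).
    pose proof (Bx i ltac:(lia)). pose proof (Bx (S i) ltac:(lia)).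
    pose proof (By j ltac:(lia)). pose proof (By (S j) ltac:(lia)).
    destruct (Rle_dec (x i) (y (S j))) as [O1|O1].
    - destruct (Rle_dec (y j) (x (S i))) as [O2|O2].
      + apply Rmult_le_compat_r.
        * unfold M. assert (s (clamp (x i) (x (S i)) (y j)) <= s (clamp (x i) (x (S i)) (y (S j))))
            by (apply Hs, clamp_mono; lra). lra.
        * apply Hf; try lra. apply Rabs_def1; lra.
      + replace (M i j) with 0; [lra|]. unfold M.
        replace (clamp (x i) (x (S i)) (y (S j))) with (clamp (x i) (x (S i)) (y j)); [ring|].
        unclamp.
    - replace (M i j) with 0; [lra|]. unfold M.
      replace (clamp (x i) (x (S i)) (y (S j))) with (clamp (x i) (x (S i)) (y j)); [ring|].
      unclamp. }
  unfold RS_sum.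
  rewrite (rsum_ext n _ (fun i => rsum m (fun j => f (t i) * M i j))).
  2:{ intros i Hi. rewrite rsum_scal, Row by easy. easy. }
  apply Rle_trans with (rsum n (fun i => rsum m (fun j => (f (r j) + eps) * M i j))).
  { apply rsum_le; intros i Hi. apply rsum_le; intros j Hj. auto. }
  rewrite rsum_swap.
  rewrite (rsum_ext m _ (fun j => 1 * (f (r j) * (s (clamp a b (y (S j))) - s (clamp a b (y j))))
      + eps * (s (clamp a b (y (S j))) - s (clamp a b (y j))))).
  2:{ intros j Hj. rewrite rsum_scal, Col by easy. ring. }
  rewrite rsum_lin, (rsum_telescope m (fun j => s (clamp a b (y j)))), Hy0, Hyn.
  replace (clamp a b b') with b by unclamp. replace (clamp a b a') with a by unclamp.
  lra.
Qed.

Lemma RS_sum_compare_same f s a b d d' n x t m y r eps :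
  nondecreasing s ->
  tagged a b d n x t -> tagged a b d' m y r ->
  (forall p q, a <= p <= b -> a <= q <= b -> Rabs (p - q) < d + d' ->
     f p <= f q + eps) ->
  RS_sum f s n x t <= RS_sum f s m y r + eps * (s b - s a).
Proof.
  intros Hs Hx Hy Hf.
  eapply Rle_trans; [apply (RS_sum_compare f s a b a b d d' n x t m y r eps); auto; lra|].
  apply Rplus_le_compat_r, Req_le, rsum_ext. intros j Hj.
  pose proof (tagged_bounds _ _ _ _ _ _ Hy j ltac:(lia)).
  pose proof (tagged_bounds _ _ _ _ _ _ Hy (S j) ltac:(lia)).
  do 2 f_equal; [|f_equal]; f_equal; unclamp.
Qed.

(** For [f >= 0] the clamped masses of the cells of the larger interval may be raised to the full
    ones. *)
Lemma RS_sum_compare_sub f s a b a' b' d d' n x t m y r eps :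
  nondecreasing s ->
  tagged a b d n x t -> tagged a' b' d' m y r -> a' <= a -> b <= b' ->
  (forall p, 0 <= f p) ->
  (forall p q, a' <= p <= b' -> a' <= q <= b' -> Rabs (p - q) < d + d' ->
     f p <= f q + eps) ->
  RS_sum f s n x t <= RS_sum f s m y r + eps * (s b - s a).
Proof.
  intros Hs Hx Hy Ha Hb Hp Hf.
  pose proof (tagged_bounds _ _ _ _ _ _ Hx O ltac:(lia)).
  eapply Rle_trans; [apply (RS_sum_compare f s a b a' b' d d' n x t m y r eps); auto|].
  apply Rplus_le_compat_r, rsum_le. intros j Hj.
  destruct Hy as (_ & _ & Hy). specialize (Hy j Hj).
  apply Rmult_le_compat_l; [auto|]. apply clamp_mass_le; auto; lra.
Qed.

Definition unif (a b : R) (n i : nat) : R := a + INR i * ((b - a) / INR n).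

Lemma unif_tagged a b delta n : a < b -> (0 < n)%nat -> (b - a) / INR n < delta ->
  tagged a b delta n (unif a b n) (unif a b n).
Proof.
  intros Hab Hn Hd. unfold tagged, unif.
  assert (0 < INR n) by (apply lt_0_INR; lia).
  assert (0 < (b - a) / INR n) by (apply Rdiv_lt_0_compat; lra).
  split; [simpl; ring|]. split; [field; lra|].
  intros i Hi. rewrite S_INR. lra.
Qed.

Lemma small_mesh a b delta : a < b -> 0 < delta ->
  exists N, forall n, (N <= n)%nat -> (0 < n)%nat /\ (b - a) / INR n < delta.
Proof.
  intros Hab Hd. destruct (INR_unbounded ((b - a) / delta)) as [N HN].
  assert (0 < (b - a) / delta) by (apply Rdiv_lt_0_compat; lra).
  exists (S N). intros n Hn. split; [lia|].
  assert (INR N < INR n) by (apply lt_INR; lia).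
  apply Rmult_lt_reg_r with (INR n); [lra|].
  replace ((b - a) / INR n * INR n) with (b - a) by (field; lra).
  replace (b - a) with ((b - a) / delta * delta) by (field; lra). nra.
Qed.

Lemma unif_exists a b delta : a < b -> 0 < delta ->
  exists n, tagged a b delta n (unif a b n) (unif a b n).
Proof.
  intros Hab Hd. destruct (small_mesh a b delta Hab Hd) as [N HN].
  exists N. destruct (HN N (le_n N)). apply unif_tagged; auto.
Qed.

Lemma RS_int_tagged f s a b I : RS_int f s a b I <->
  a < b /\ forall eps, 0 < eps -> exists delta, 0 < delta /\
    forall n x t, tagged a b delta n x t -> Rabs (RS_sum f s n x t - I) < eps.
Proof.
  split; intros [Hab H]; (split; [easy|]); intros eps He;
    destruct (H eps He) as (delta & Hd & Hdelta); exists delta; (split; [easy|]).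
  - intros n x t (H1 & H2 & H3). apply Hdelta; auto.
  - intros n x t H1 H2 H3. apply Hdelta. split; auto.
Qed.

Lemma tagged_weaken a b d d' n x t : d <= d' ->
  tagged a b d n x t -> tagged a b d' n x t.
Proof.
  intros Hd (H1 & H2 & H3). split; [easy|]. split; [easy|].
  intros i Hi. specialize (H3 i Hi). lra.
Qed.

(** Reduces statements about integrals to statements about sums: one uniform partition, fine enough
    for both limits, serves two integrals at once. *)
Lemma RS_int_approx2 f g s s' a b I J eps : 0 < eps ->
  RS_int f s a b I -> RS_int g s' a b J ->
  exists n x t, Rabs (RS_sum f s n x t - I) < eps /\
    Rabs (RS_sum g s' n x t - J) < eps /\ tagged a b 1 n x t.
Proof.
  rewrite !RS_int_tagged. intros He [Hab Hf] [_ Hg].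
  destruct (Hf eps He) as (d1 & Hd1 & H1), (Hg eps He) as (d2 & Hd2 & H2).
  set (d := Rmin 1 (Rmin d1 d2)).
  assert (d <= 1 /\ d <= d1 /\ d <= d2 /\ 0 < d) as (B1 & B2 & B3 & B4)
    by (unfold d, Rmin; repeat destruct Rle_dec; lra).
  destruct (unif_exists a b d Hab B4) as [n Hn].
  exists n, (unif a b n), (unif a b n). repeat split.
  - apply H1, tagged_weaken with d; auto.
  - apply H2, tagged_weaken with d; auto.
  - apply Hn.
  - apply Hn.
  - apply Hn; easy.
  - destruct Hn as (_ & _ & Hn). specialize (Hn _ H). lra.
  - apply Hn; easy.
  - apply Hn; easy.
Qed.

Lemma RS_int_unique f s a b I J : RS_int f s a b I -> RS_int f s a b J -> I = J.
Proof.
  intros HI HJ. apply Rminus_diag_uniq, NNPP. intros Hne.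
  assert (0 < Rabs (I - J)) by (apply Rabs_pos_lt; easy).
  destruct (RS_int_approx2 f f s s a b I J (Rabs (I - J) / 2) ltac:(lra) HI HJ)
    as (n & x & t & H1 & H2 & _).
  revert H H1 H2. unfold Rabs. repeat destruct Rcase_abs; lra.
Qed.

Lemma RS_int_ext f g s a b I : (forall x, f x = g x) ->
  RS_int f s a b I -> RS_int g s a b I.
Proof.
  intros Hfg [Hab H]. split; [easy|]. intros eps He.
  destruct (H eps He) as (d & Hd & Hdelta). exists d; split; [easy|].
  intros n x t H1 H2 H3.
  rewrite (rsum_ext n _ (fun i => f (t i) * (s (x (S i)) - s (x i))))
    by (intros; rewrite Hfg; easy).
  auto.
Qed.

Lemma RS_int_lin f g s a b p q I J :
  RS_int f s a b I -> RS_int g s a b J ->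
  RS_int (fun x => p * f x + q * g x) s a b (p * I + q * J).
Proof.
  rewrite !RS_int_tagged. intros [Hab Hf] [_ Hg]. split; [easy|]. intros eps He.
  set (K := Rabs p + Rabs q + 1).
  assert (HK : 0 < K) by (unfold K; pose proof (Rabs_pos p); pose proof (Rabs_pos q); lra).
  assert (He' : 0 < eps / K) by (apply Rdiv_lt_0_compat; lra).
  destruct (Hf _ He') as (d1 & Hd1 & H1), (Hg _ He') as (d2 & Hd2 & H2).
  exists (Rmin d1 d2). split; [apply Rmin_glb_lt; lra|].
  intros n x t Hx.
  specialize (H1 n x t (tagged_weaken _ _ _ _ _ _ _ (Rmin_l d1 d2) Hx)).
  specialize (H2 n x t (tagged_weaken _ _ _ _ _ _ _ (Rmin_r d1 d2) Hx)).
  replace (RS_sum (fun x => p * f x + q * g x) s n x t)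
    with (p * RS_sum f s n x t + q * RS_sum g s n x t).
  2:{ unfold RS_sum. rewrite <- rsum_lin. apply rsum_ext; intros; ring. }
  replace (p * RS_sum f s n x t + q * RS_sum g s n x t - (p * I + q * J))
    with (p * (RS_sum f s n x t - I) + q * (RS_sum g s n x t - J)) by ring.
  eapply Rle_lt_trans; [apply Rabs_triang|]. rewrite !Rabs_mult.
  replace eps with (K * (eps / K)) by (field; lra). unfold K at 1.
  pose proof (Rabs_pos p); pose proof (Rabs_pos q). nra.
Qed.

Lemma uniform_bound f a b eps : continuity f -> 0 < eps -> a <= b ->
  exists d, 0 < d /\ forall p q, a <= p <= b -> a <= q <= b ->
    Rabs (p - q) < d -> f p <= f q + eps.
Proof.
  intros Hf He Hab.
  destruct (Heine f (fun c => a <= c <= b) (compact_P3 a b) (fun x _ => Hf x)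
    (mkposreal eps He)) as [d Hd].
  exists d. split; [apply cond_pos|]. intros p q Hp Hq Hpq.
  specialize (Hd p q Hp Hq Hpq). simpl in Hd. apply Rabs_def2 in Hd. lra.
Qed.

(** By uniform continuity on [[a, b]] the sums over fine partitions form a Cauchy family; the limit
    is taken along uniform partitions. *)
Lemma RS_int_exists f s a b : continuity f -> nondecreasing s -> a < b ->
  exists I, RS_int f s a b I.
Proof.
  intros Hf Hs Hab.
  assert (HV : 0 <= s b - s a) by (assert (s a <= s b) by (apply Hs; lra); lra).
  assert (Key : forall eps, 0 < eps -> exists d, 0 < d /\ forall n x t m y r,
    tagged a b d n x t -> tagged a b d m y r ->
    Rabs (RS_sum f s n x t - RS_sum f s m y r) < eps).
  (* The [+ 1] keeps the denominator positive when [s] has no mass on [[a, b]]. *)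
  { intros eps He. set (e := eps / (s b - s a + 1)).
    assert (0 < e) by (apply Rdiv_lt_0_compat; lra).
    destruct (uniform_bound f a b e Hf H ltac:(lra)) as (d & Hd & Hu).
    exists (d / 2). split; [lra|]. intros n x t m y r Hx Hy.
    assert (Hu' : forall p q, a <= p <= b -> a <= q <= b ->
      Rabs (p - q) < d / 2 + d / 2 -> f p <= f q + e)
      by (intros; apply Hu; auto; lra).
    pose proof (RS_sum_compare_same _ _ _ _ _ _ _ _ _ _ _ _ _ Hs Hx Hy Hu').
    pose proof (RS_sum_compare_same _ _ _ _ _ _ _ _ _ _ _ _ _ Hs Hy Hx Hu').
    assert (e * (s b - s a + 1) = eps) by (unfold e; field; lra).
    apply Rabs_def1; nra. }
  set (u := fun n => RS_sum f s n (unif a b n) (unif a b n)).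
  assert (Hu : Cauchy_crit u).
  { intros eps He. destruct (Key eps He) as (d & Hd & HK).
    destruct (small_mesh a b d Hab Hd) as [N HN].
    exists N. intros n m Hn Hm. apply HK; apply unif_tagged; try apply HN; auto. }
  destruct (R_complete u Hu) as [I HI]. exists I.
  apply RS_int_tagged. split; [easy|]. intros eps He.
  destruct (Key (eps / 2) ltac:(lra)) as (d & Hd & HK). exists d. split; [easy|].
  intros n x t Hx.
  destruct (small_mesh a b d Hab Hd) as [N HN].
  destruct (HI (eps / 2) ltac:(lra)) as [N' HN'].
  set (m := Nat.max N N').
  specialize (HN' m ltac:(lia)). unfold Rdist in HN'.
  specialize (HK n x t m (unif a b m) (unif a b m) Hx
    (unif_tagged a b d m Hab (proj1 (HN m ltac:(lia))) (proj2 (HN m ltac:(lia))))).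
  unfold u in HN'. replace (RS_sum f s n x t - I)
    with ((RS_sum f s n x t - RS_sum f s m (unif a b m) (unif a b m)) +
          (RS_sum f s m (unif a b m) (unif a b m) - I)) by ring.
  eapply Rle_lt_trans; [apply Rabs_triang|lra].
Qed.

Lemma RS_int_ge0 f s a b I : nondecreasing s -> (forall x, 0 <= f x) ->
  RS_int f s a b I -> 0 <= I.
Proof.
  intros Hs Hf HI. apply Rnot_lt_le; intros Hneg.
  destruct (RS_int_approx2 f f s s a b I I (- I) ltac:(lra) HI HI)
    as (n & x & t & H1 & _ & _ & _ & Hx).
  assert (0 <= RS_sum f s n x t).
  { unfold RS_sum. rewrite <- (rsum_zero n (fun _ => 0)) by easy.
    apply rsum_le. intros i Hi. specialize (Hx i Hi).
    assert (s (x i) <= s (x (S i))) by (apply Hs; lra).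
    apply Rmult_le_pos; [auto|lra]. }
  apply Rabs_def2 in H1. lra.
Qed.

Lemma RS_int_interval_mono f s a b a' b' I J : nondecreasing s ->
  continuity f -> (forall x, 0 <= f x) -> a' <= a -> b <= b' ->
  RS_int f s a b I -> RS_int f s a' b' J -> I <= J.
Proof.
  intros Hs Hc Hf Ha Hb. rewrite !RS_int_tagged. intros [Hab HI] [Hab' HJ].
  apply Rnot_lt_le; intros Hlt.
  assert (HV : 0 <= s b - s a) by (assert (s a <= s b) by (apply Hs; lra); lra).
  (* Three errors, each at most a quarter of the presumed excess [I - J]: two approximations of
     integrals and the oscillation term. *)
  set (e := (I - J) / 4 / (s b - s a + 1)).
  assert (He : 0 < e) by (unfold e; repeat apply Rdiv_lt_0_compat; lra).
  assert (He' : e * (s b - s a + 1) = (I - J) / 4) by (unfold e; field; lra).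
  destruct (uniform_bound f a' b' e Hc He ltac:(lra)) as (d & Hd & Hu).
  destruct (HI ((I - J) / 4) ltac:(lra)) as (d1 & Hd1 & H1).
  destruct (HJ ((I - J) / 4) ltac:(lra)) as (d2 & Hd2 & H2).
  destruct (unif_exists a b (Rmin d1 (d / 2)) Hab ltac:(apply Rmin_glb_lt; lra)) as [n Hn].
  destruct (unif_exists a' b' (Rmin d2 (d / 2)) Hab' ltac:(apply Rmin_glb_lt; lra)) as [m Hm].
  specialize (H1 _ _ _ (tagged_weaken _ _ _ _ _ _ _ (Rmin_l d1 (d/2)) Hn)).
  specialize (H2 _ _ _ (tagged_weaken _ _ _ _ _ _ _ (Rmin_l d2 (d/2)) Hm)).
  apply (tagged_weaken _ _ _ _ _ _ _ (Rmin_r d1 (d/2))) in Hn.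
  apply (tagged_weaken _ _ _ _ _ _ _ (Rmin_r d2 (d/2))) in Hm.
  pose proof (RS_sum_compare_sub f s a b a' b' (d/2) (d/2) _ _ _ _ _ _ e Hs Hn Hm Ha Hb Hf
    ltac:(intros; apply Hu; auto; lra)).
  apply Rabs_def2 in H1. apply Rabs_def2 in H2. nra.
Qed.

(** * Improper integrals *)

Lemma RS_int_R_ext f g s I : (forall x, f x = g x) ->
  RS_int_R f s I -> RS_int_R g s I.
Proof.
  intros Hfg [H1 H2]. split.
  - intros a b Hab. destruct (H1 a b Hab) as [J HJ]. exists J.
    apply RS_int_ext with f; auto.
  - intros eps He. destruct (H2 eps He) as [M HM]. exists M.
    intros a b J Ha Hb HJ. apply (HM a b); auto. apply RS_int_ext with g; auto.
Qed.

Lemma RS_int_R_approx2 f g s I J eps : 0 < eps ->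
  RS_int_R f s I -> RS_int_R g s J ->
  exists a b I' J', RS_int f s a b I' /\ RS_int g s a b J' /\
    Rabs (I' - I) < eps /\ Rabs (J' - J) < eps.
Proof.
  intros He [Hf1 Hf2] [Hg1 Hg2].
  destruct (Hf2 eps He) as [M HM], (Hg2 eps He) as [M' HM'].
  set (b := Rmax 0 (Rmax M M') + 1).
  assert (0 < b /\ M < b /\ M' < b) as (B1 & B2 & B3)
    by (unfold b, Rmax; repeat destruct Rle_dec; lra).
  destruct (Hf1 (-b) b ltac:(lra)) as [I' HI'], (Hg1 (-b) b ltac:(lra)) as [J' HJ'].
  exists (-b), b, I', J'. repeat (split; [assumption|]).
  split; [apply (HM (-b) b)|apply (HM' (-b) b)]; auto; lra.
Qed.

Lemma RS_int_R_unique f s I J : RS_int_R f s I -> RS_int_R f s J -> I = J.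
Proof.
  intros HI HJ. apply Rminus_diag_uniq, NNPP. intros Hne.
  assert (0 < Rabs (I - J)) by (apply Rabs_pos_lt; easy).
  destruct (RS_int_R_approx2 f f s I J (Rabs (I - J) / 2) ltac:(lra) HI HJ)
    as (a & b & I' & J' & H1 & H2 & H3 & H4).
  rewrite (RS_int_unique _ _ _ _ _ _ H1 H2) in H3.
  revert H H3 H4. unfold Rabs. repeat destruct Rcase_abs; lra.
Qed.

Lemma RS_int_R_ge0 f s I : nondecreasing s -> (forall x, 0 <= f x) ->
  RS_int_R f s I -> 0 <= I.
Proof.
  intros Hs Hf HI. apply Rnot_lt_le; intros Hneg.
  destruct (RS_int_R_approx2 f f s I I (- I) ltac:(lra) HI HI)
    as (a & b & I' & J' & H1 & H2 & H3 & _).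
  apply RS_int_ge0 in H1; auto. apply Rabs_def2 in H3. lra.
Qed.

Lemma RS_int_R_lin f g s p q I J :
  RS_int_R f s I -> RS_int_R g s J ->
  RS_int_R (fun x => p * f x + q * g x) s (p * I + q * J).
Proof.
  intros [Hf1 Hf2] [Hg1 Hg2]. split.
  - intros a b Hab. destruct (Hf1 a b Hab) as [I' HI], (Hg1 a b Hab) as [J' HJ].
    exists (p * I' + q * J'). apply RS_int_lin; auto.
  - intros eps He.
    set (K := Rabs p + Rabs q + 1).
    assert (HK : 0 < K) by (unfold K; pose proof (Rabs_pos p); pose proof (Rabs_pos q); lra).
    assert (He' : 0 < eps / K) by (apply Rdiv_lt_0_compat; lra).
    destruct (Hf2 _ He') as [M HM], (Hg2 _ He') as [M' HM'].
    exists (Rmax M M'). intros a b L Ha Hb HL.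
    pose proof (Rmax_l M M'). pose proof (Rmax_r M M').
    assert (Hab : a < b) by apply HL.
    destruct (Hf1 a b Hab) as [I' HI], (Hg1 a b Hab) as [J' HJ].
    rewrite (RS_int_unique _ _ _ _ _ _ HL (RS_int_lin _ _ _ _ _ p q _ _ HI HJ)).
    specialize (HM a b I' ltac:(lra) ltac:(lra) HI).
    specialize (HM' a b J' ltac:(lra) ltac:(lra) HJ).
    replace (p * I' + q * J' - (p * I + q * J))
      with (p * (I' - I) + q * (J' - J)) by ring.
    eapply Rle_lt_trans; [apply Rabs_triang|]. rewrite !Rabs_mult.
    replace eps with (K * (eps / K)) by (field; lra). unfold K at 1.
    pose proof (Rabs_pos p); pose proof (Rabs_pos q). nra.
Qed.

(** The integrals of [f] over bounded intervals increase with the interval and are bounded through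
    [g]; the improper integral is their supremum. *)
Lemma RS_int_R_dominated_ge0 f g s I : nondecreasing s ->
  continuity f -> continuity g -> (forall x, 0 <= f x <= g x) ->
  RS_int_R g s I -> exists J, RS_int_R f s J.
Proof.
  intros Hs Hf Hg Hfg [HI1 HI2].
  set (X := fun J => exists a b, RS_int f s a b J).
  assert (Bound : forall a b J, RS_int f s a b J -> J <= I + 1).
  { intros a b J HJ. destruct (HI2 1 ltac:(lra)) as [M HM].
    (* The interval is enlarged until the integral of [g] over it is within 1 of [I]. *)
    set (a' := Rmin a (- M) - 1). set (b' := Rmax b M + 1).
    assert (a' < a /\ a' < - M) as [A1 A2] by (unfold a', Rmin; destruct Rle_dec; lra).
    assert (b < b' /\ M < b') as [B1 B2] by (unfold b', Rmax; destruct Rle_dec; lra).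
    assert (Hab : a < b) by apply HJ.
    destruct (RS_int_exists f s a' b' Hf Hs ltac:(lra)) as [J' HJ'].
    destruct (RS_int_exists g s a' b' Hg Hs ltac:(lra)) as [I' HI'].
    assert (J <= J').
    { apply (RS_int_interval_mono f s a b a' b'); auto; try lra. intros; apply Hfg. }
    assert (0 <= 1 * I' + (-1) * J').
    { apply (RS_int_ge0 (fun x => 1 * g x + (-1) * f x) s a' b'); auto.
      - intros x. specialize (Hfg x). lra.
      - apply RS_int_lin; auto. }
    specialize (HM a' b' I' ltac:(lra) ltac:(lra) HI'). apply Rabs_def2 in HM. lra. }
  destruct (completeness X) as [J [HJ1 HJ2]].
  - exists (I + 1). intros J (a & b & HJ). eauto.
  - destruct (RS_int_exists f s 0 1 Hf Hs ltac:(lra)) as [J HJ]. exists J, 0, 1; auto.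
  - exists J. split.
    + intros a b Hab. apply RS_int_exists; auto.
    + intros eps He.
      assert (exists a b K, RS_int f s a b K /\ J - eps < K) as (a & b & K & HK & HKJ).
      { apply NNPP. intros Hn. assert (J <= J - eps); [|lra].
        apply HJ2. intros K (a & b & HK). apply Rnot_lt_le. intros Hlt.
        apply Hn. exists a, b, K. auto. }
      exists (Rmax (Rabs a) (Rabs b)). intros a' b' K' Ha' Hb' HK'.
      pose proof (Rmax_l (Rabs a) (Rabs b)). pose proof (Rmax_r (Rabs a) (Rabs b)).
      pose proof (Rle_abs (- a)). rewrite Rabs_Ropp in H1. pose proof (Rle_abs b).
      assert (K <= K').
      { apply (RS_int_interval_mono f s a b a' b'); auto; try lra. intros; apply Hfg. }
      assert (K' <= J) by (apply HJ1; exists a', b'; auto).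
      apply Rabs_def1; lra.
Qed.

(** The nonnegative case applies to [f + g], which lies between 0 and [2 g]; then [g] is subtracted
    again. *)
Lemma RS_int_R_dominated f g s I : nondecreasing s ->
  continuity f -> continuity g -> (forall x, Rabs (f x) <= g x) ->
  RS_int_R g s I -> exists J, RS_int_R f s J.
Proof.
  intros Hs Hf Hg Hfg HI.
  assert (B : forall x, 0 <= f x + g x <= 2 * g x).
  { intros x. specialize (Hfg x). revert Hfg. unfold Rabs. destruct Rcase_abs; lra. }
  destruct (RS_int_R_dominated_ge0 (f + g)%F (mult_real_fct 2 g) s (2 * I + 0 * I))
    as [J HJ]; auto.
  - apply continuity_plus; auto.
  - apply continuity_scal; auto.
  - apply RS_int_R_ext with (fun x => 2 * g x + 0 * g x).
    + intros x. unfold mult_real_fct. ring.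
    + apply RS_int_R_lin; auto.
  - exists (1 * J + (-1) * I).
    apply RS_int_R_ext with (fun x => 1 * (f + g)%F x + (-1) * g x).
    + intros x. unfold plus_fct. ring.
    + apply RS_int_R_lin; auto.
Qed.

(** * Positive functionals on functions of polynomial growth *)

(** The weight [(1 + x^2)^m] is a polynomial, so finite moments control its integral; it increases
    with [m], so two bounds can be merged into one. *)
Definition good (f : R -> R) : Prop :=
  continuity f /\
  exists C m, 0 <= C /\ forall x, Rabs (f x) <= C * (1 + x * x) ^ m.

Lemma weight_mono x m n : (m <= n)%nat -> (1 + x * x) ^ m <= (1 + x * x) ^ n.
Proof. intros H. apply Rle_pow; [nra|easy]. Qed.

Lemma good_bounded f C : continuity f -> (forall x, Rabs (f x) <= C) -> good f.
Proof.
  intros Hf HC. split; [easy|]. exists C, O. split.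
  - specialize (HC 0). pose proof (Rabs_pos (f 0)). lra.
  - intros x. simpl. rewrite Rmult_1_r. auto.
Qed.

Lemma good_const c : good (fun _ => c).
Proof.
  apply good_bounded with (Rabs c); [|intros; lra].
  apply continuity_const. intros x y; easy.
Qed.

Lemma good_id : good (fun x => x).
Proof.
  split; [apply derivable_continuous, derivable_id|].
  exists 1, 1%nat. split; [lra|]. intros x. simpl.
  unfold Rabs; destruct Rcase_abs; nra.
Qed.

Lemma good_mult f g : good f -> good g -> good (fun x => f x * g x).
Proof.
  intros [Hf (C & m & HC & Bf)] [Hg (D & n & HD & Bg)]. split.
  - apply (continuity_mult f g); auto.
  - exists (C * D), (m + n)%nat. split; [nra|]. intros x.
    rewrite Rabs_mult, pow_add.
    replace (C * D * ((1 + x * x) ^ m * (1 + x * x) ^ n))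
      with ((C * (1 + x * x) ^ m) * (D * (1 + x * x) ^ n)) by ring.
    apply Rmult_le_compat; auto using Rabs_pos.
Qed.

Lemma good_plus f g : good f -> good g -> good (fun x => f x + g x).
Proof.
  intros [Hf (C & m & HC & Bf)] [Hg (D & n & HD & Bg)]. split.
  - apply (continuity_plus f g); auto.
  - exists (C + D), (m + n)%nat. split; [lra|]. intros x.
    eapply Rle_trans; [apply Rabs_triang|].
    specialize (Bf x). specialize (Bg x).
    pose proof (weight_mono x m (m + n) ltac:(lia)).
    pose proof (weight_mono x n (m + n) ltac:(lia)). nra.
Qed.

Lemma good_scal c f : good f -> good (fun x => c * f x).
Proof. intros H. apply (good_mult (fun _ => c) f); auto using good_const. Qed.

Lemma good_lin a b f g : good f -> good g -> good (fun x => a * f x + b * g x).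
Proof.
  intros Hf Hg. apply (good_plus (fun x => a * f x) (fun x => b * g x));
    apply good_scal; auto.
Qed.

Lemma good_pow k : good (fun x => x ^ k).
Proof.
  induction k as [|k IH]; simpl; [apply good_const|].
  apply (good_mult (fun x => x) (fun x => x ^ k)); auto using good_id.
Qed.

Lemma good_rsum n (f : nat -> R -> R) : (forall i, good (f i)) ->
  good (fun x => rsum n (fun i => f i x)).
Proof.
  intros H. induction n as [|n IH]; simpl; [apply good_const|].
  apply (good_plus (fun x => rsum n (fun i => f i x)) (f n)); auto.
Qed.

Lemma good_pevalR p n : good (pevalR p n).
Proof.
  unfold pevalR. apply (good_rsum (S n) (fun j x => p j * x ^ j)).
  intros j. apply good_scal, good_pow.
Qed.

Lemma good_pullback f d l : (1 <= d)%nat -> good f ->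
  good (fun x => x ^ l * f (x ^ d)).
Proof.
  intros Hd [Hf (C & m & HC & Bf)].
  apply (good_mult (fun x => x ^ l) (fun x => f (x ^ d))); [apply good_pow|].
  split.
  - apply (continuity_comp (fun x => x ^ d) f); [apply good_pow|easy].
  - exists C, (d * m)%nat. split; [easy|]. intros x.
    eapply Rle_trans; [apply Bf|]. apply Rmult_le_compat_l; [easy|].
    rewrite pow_mult. apply pow_incr. split; [nra|].
    (* What remains is [1 + x^(2d) <= (1 + x^2)^d]. The induction starts at [d = 1]; for [d = 0] the
       claim would read [2 <= 1]. *)
    destruct d as [|d]; [lia|]. clear. induction d as [|d IH].
    + simpl. nra.
    + replace (x ^ S (S d) * x ^ S (S d)) with ((x * x) * (x ^ S d * x ^ S d)) by (simpl; ring).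
      replace ((1 + x * x) ^ S (S d)) with ((1 + x * x) ^ S d + (x * x) * (1 + x * x) ^ S d)
        by (simpl; ring).
      pose proof (Rle_0_sqr x). unfold Rsqr in H.
      pose proof (Rle_0_sqr (x ^ S d)). unfold Rsqr in H0. nra.
Qed.

(** Linearity is demanded only on [good] functions: [mu] is total and may take arbitrary values on
    functions without an integral. *)
Record positive_functional (mu : (R -> R) -> R) : Prop := {
  pf_lin : forall a b f g, good f -> good g ->
    mu (fun x => a * f x + b * g x) = a * mu f + b * mu g;
  pf_ge0 : forall f, good f -> (forall x, 0 <= f x) -> 0 <= mu f }.

Lemma functional_ext (mu : (R -> R) -> R) f g :
  (forall x, f x = g x) -> mu f = mu g.
Proof. intros H. f_equal. extensionality x. apply H. Qed.

(** * Integration against a moment solution, and its pullback *)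

Lemma moment_weight_integrable s sigma : moment_solution s sigma ->
  forall m k, exists I, RS_int_R (fun x => x ^ k * (1 + x * x) ^ m) sigma I.
Proof.
  intros [_ H]. induction m as [|m IH]; intros k.
  - exists (s k). apply RS_int_R_ext with (fun x => x ^ k); [intros; simpl; ring|auto].
  (* One factor [1 + x^2] splits into the exponents [k] and [k + 2], which is why [k] is kept
     general. *)
  - destruct (IH k) as [I HI], (IH (S (S k))) as [J HJ].
    exists (1 * I + 1 * J).
    eapply RS_int_R_ext; [|apply RS_int_R_lin; [exact HI|exact HJ]].
    intros x. simpl. ring.
Qed.

Lemma good_integrable s sigma f : moment_solution s sigma -> good f ->
  exists I, RS_int_R f sigma I.
Proof.
  intros Hs [Hf (C & m & HC & Bf)].
  destruct (moment_weight_integrable s sigma Hs m O) as [I HI].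
  apply RS_int_R_dominated with (fun x => C * (1 + x * x) ^ m) (C * I + 0 * I); auto.
  - apply Hs.
  - change (continuity (mult_real_fct C (fun x => (1 + x * x) ^ m))).
    apply continuity_scal.
    assert (G : good (fun x => 1 + x * x)).
    { apply (good_plus (fun _ => 1) (fun x => x * x)); [apply good_const|].
      apply (good_mult (fun x => x) (fun x => x)); apply good_id. }
    clear - G. induction m as [|m IH]; simpl.
    + apply good_const.
    + apply (continuity_mult (fun x => 1 + x * x) (fun x => (1 + x * x) ^ m)); auto.
      apply G.
  - eapply RS_int_R_ext; [|apply RS_int_R_lin; [exact HI|exact HI]].
    intros x. simpl. ring.
Qed.

Definition stieltjes (sigma : R -> R) (f : R -> R) : R :=
  epsilon (inhabits 0) (RS_int_R f sigma).

Section Stieltjes.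

Variables (s : nat -> R) (sigma : R -> R).
Hypothesis Hs : moment_solution s sigma.

Lemma stieltjes_spec f : good f -> RS_int_R f sigma (stieltjes sigma f).
Proof. intros Hf. unfold stieltjes; apply epsilon_spec. apply (good_integrable s); auto. Qed.

Lemma stieltjes_eq f I : RS_int_R f sigma I -> stieltjes sigma f = I.
Proof.
  intros H. apply RS_int_R_unique with f sigma; [|easy].
  unfold stieltjes; apply epsilon_spec. exists I; easy.
Qed.

Lemma stieltjes_positive : positive_functional (stieltjes sigma).
Proof.
  split.
  - intros a b f g Hf Hg. apply stieltjes_eq, RS_int_R_lin; apply stieltjes_spec; easy.
  - intros f Hf Hp. apply (RS_int_R_ge0 f sigma); auto; [apply Hs|].
    apply stieltjes_spec; easy.
Qed.

Lemma stieltjes_moment k : stieltjes sigma (fun x => x ^ k) = s k.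
Proof. apply stieltjes_eq, Hs. Qed.

(** This is integration against the image of [x^l dsigma] under [x |-> x^d]; an even [l] makes the
    weight nonnegative. *)
Lemma pullback_positive d l : (1 <= d)%nat -> Nat.even l = true ->
  positive_functional (fun f => stieltjes sigma (fun x => x ^ l * f (x ^ d))).
Proof.
  intros Hd Hl. split.
  - intros a b f g Hf Hg. rewrite <- (pf_lin _ stieltjes_positive) by (apply good_pullback; auto).
    apply functional_ext; intros; ring.
  - intros f Hf Hp. apply (pf_ge0 _ stieltjes_positive).
    + apply good_pullback; auto.
    + intros x. apply Rmult_le_pos; auto.
      apply Nat.even_spec in Hl. destruct Hl as [m ->]. rewrite pow_mult.
      apply pow_le. simpl. nra.
Qed.

Lemma pullback_moment d l k :
  stieltjes sigma (fun x => x ^ l * (x ^ d) ^ k) = s (k * d + l)%nat.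
Proof.
  rewrite <- stieltjes_moment. apply functional_ext. intros x.
  rewrite pow_add, Nat.mul_comm, pow_mult. ring.
Qed.

End Stieltjes.

(** * Positive functionals on polynomials *)

Section Functional.

Variable mu : (R -> R) -> R.
Hypothesis Hmu : positive_functional mu.

Lemma pf_scal a f : good f -> mu (fun x => a * f x) = a * mu f.
Proof.
  intros Hf. replace (a * mu f) with (a * mu f + 0 * mu f) by ring.
  rewrite <- (pf_lin _ Hmu) by easy. apply functional_ext; intros; ring.
Qed.

Lemma pf_rsum n a (f : nat -> R -> R) : (forall i, good (f i)) ->
  mu (fun x => rsum n (fun i => a i * f i x)) = rsum n (fun i => a i * mu (f i)).
Proof.
  intros Hf. induction n as [|n IH]; simpl.
  - transitivity (mu (fun x => 0 * 1)); [apply functional_ext; intros; ring|].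
    rewrite (pf_scal 0 (fun _ => 1)) by apply good_const. ring.
  - rewrite <- IH.
    transitivity (mu (fun x => 1 * rsum n (fun i => a i * f i x) + a n * f n x)).
    + apply functional_ext; intros; ring.
    + rewrite (pf_lin _ Hmu); [ring| |auto].
      apply (good_rsum n (fun i x => a i * f i x)). intros; apply good_scal; auto.
Qed.

Lemma pf_pevalR_mult p n h : good h ->
  mu (fun x => pevalR p n x * h x) =
  rsum (S n) (fun i => p i * mu (fun x => x ^ i * h x)).
Proof.
  intros Hh. rewrite <- (pf_rsum (S n) p (fun i x => x ^ i * h x)).
  - apply functional_ext; intros x. unfold pevalR.
    rewrite Rmult_comm, <- rsum_scal. apply rsum_ext; intros; ring.
  - intros i. apply (good_mult (fun x => x ^ i) h); auto using good_pow.
Qed.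

(** Only moments occur on the right. Orthonormality with respect to [sigt] thus becomes a condition
    on [st] and carries over to every positive functional with the same moments. *)
Lemma pf_pevalR_pevalR st p n q m : (forall k, mu (fun x => x ^ k) = st k) ->
  mu (fun x => pevalR p n x * pevalR q m x) =
  rsum (S n) (fun i => p i * rsum (S m) (fun j => q j * st (i + j)%nat)).
Proof.
  intros Hst. rewrite pf_pevalR_mult by apply good_pevalR.
  apply rsum_ext; intros i _. f_equal.
  transitivity (mu (fun x => pevalR q m x * x ^ i)).
  - apply functional_ext; intros; ring.
  - rewrite pf_pevalR_mult by apply good_pow.
    apply rsum_ext; intros j _. f_equal. rewrite <- Hst.
    apply functional_ext; intros. rewrite pow_add. ring.
Qed.

End Functional.

(** * Three-term recurrence *)

Lemma rsum_extend n N f : (n <= N)%nat ->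
  (forall j, (n <= j)%nat -> f j = 0) -> rsum N f = rsum n f.
Proof.
  intros H Hf. induction H as [|N H IH]; [easy|].
  simpl. rewrite IH, Hf by easy. ring.
Qed.

Lemma rsum_shift n f : rsum (S n) f = f O + rsum n (fun i => f (S i)).
Proof.
  induction n as [|n IH]; [simpl; ring|].
  change (rsum (S (S n)) f) with (rsum (S n) f + f (S n)). rewrite IH. simpl. ring.
Qed.

Section Recurrence.

Variables (st : nat -> R) (P : nat -> nat -> R).
Hypothesis P_deg : forall k j, (k < j)%nat -> P k j = 0.
Hypothesis P_lead : forall k, 0 < P k k.

(* The linear functional [x^j |-> lam j] applied to [P k]. *)
Definition Lam (lam : nat -> R) (k : nat) : R :=
  rsum (S k) (fun j => P k j * lam j).

Hypothesis P_orth : forall k m,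
  rsum (S m) (fun i => P m i * Lam (fun j => st (i + j)%nat) k) =
  if Nat.eqb k m then 1 else 0.

(** In the orthogonality of [P k] and [P i] the powers below [i] drop out by induction, and the
    leading coefficient [P i i] can be cancelled. *)
Lemma Lam_moment_low k i : (i < k)%nat -> Lam (fun j => st (i + j)%nat) k = 0.
Proof.
  induction i as [i IH] using (well_founded_induction Wf_nat.lt_wf). intros Hi.
  pose proof (P_orth k i) as H.
  replace (Nat.eqb k i) with false in H by (symmetry; apply Nat.eqb_neq; lia).
  simpl in H. rewrite rsum_zero in H by (intros m Hm; rewrite IH by lia; ring).
  pose proof (P_lead i). nra.
Qed.

Lemma Lam_moment_diag k : P k k * Lam (fun j => st (k + j)%nat) k = 1.
Proof.
  pose proof (P_orth k k) as H. rewrite Nat.eqb_refl in H. simpl in H.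
  rewrite rsum_zero in H by (intros m Hm; rewrite Lam_moment_low by lia; ring).
  lra.
Qed.

(** Nonsingularity of the Hankel matrix of size [n], without determinants. Pairing a null vector of
    size [S n] with the coefficients of [P n] annihilates all powers below [n] and leaves
    [rho n / P n n = 0]; then the size drops by one. *)
Lemma moment_nondegenerate n : forall rho : nat -> R,
  (forall j, (n <= j)%nat -> rho j = 0) ->
  (forall i, (i < n)%nat -> rsum n (fun j => rho j * st (i + j)%nat) = 0) ->
  forall j, rho j = 0.
Proof.
  induction n as [|n IH]; intros rho Hd Ho; [intros; apply Hd; lia|].
  assert (Hn : rho n = 0).
  { assert (H : rsum (S n) (fun i => P n i * rsum (S n) (fun j => rho j * st (i + j)%nat)) = 0).
    { apply rsum_zero; intros i Hi. rewrite Ho by easy. ring. }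
    rewrite (rsum_ext _ _ (fun i => rsum (S n) (fun j => P n i * (rho j * st (i + j)%nat)))) in H
      by (intros; rewrite rsum_scal; easy).
    rewrite rsum_swap in H.
    rewrite (rsum_ext _ _ (fun j => rho j * Lam (fun i => st (j + i)%nat) n)) in H.
    2:{ intros j Hj. unfold Lam. rewrite <- rsum_scal. apply rsum_ext; intros i Hi.
        rewrite (Nat.add_comm j i). ring. }
    change (rsum n (fun j => rho j * Lam (fun i => st (j + i)%nat) n)
      + rho n * Lam (fun i => st (n + i)%nat) n = 0) in H.
    rewrite rsum_zero in H by (intros j Hj; rewrite Lam_moment_low by easy; ring).
    pose proof (Lam_moment_diag n) as D. rewrite <- (Rmult_1_r (rho n)), <- D.
    rewrite Rplus_0_l in H.
    replace (rho n * (P n n * _)) with (P n n * (rho n * Lam (fun i => st (n + i)%nat) n))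
      by ring.
    rewrite H. ring. }
  apply IH.
  - intros j Hj. destruct (Nat.eq_dec j n) as [->|]; [easy|apply Hd; lia].
  - intros i Hi. specialize (Ho i ltac:(lia)). simpl in Ho. rewrite Hn in Ho. lra.
Qed.

(** Jacobi parameters of [x P_k = b_k P_(k+1) + a_k P_k + b_(k-1) P_(k-1)]: [jac_b] and [jac_a] are
    read off from the coefficients of degree [k + 1] and [k], and [prev] is the last term. *)
Definition jac_b (k : nat) : R := P k k / P (S k) (S k).
Definition shiftc (p : nat -> R) (j : nat) : R :=
  match j with O => 0 | S j => p j end.
Definition jac_a (k : nat) : R :=
  (shiftc (P k) k - jac_b k * P (S k) k) / P k k.
Definition prev (k : nat) (u : nat -> R) : R :=
  match k with O => 0 | S k => jac_b k * u k end.

Lemma Lam_extend lam k N : (k < N)%nat ->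
  rsum N (fun j => P k j * lam j) = Lam lam k.
Proof.
  intros H. apply rsum_extend; [easy|]. intros j Hj. rewrite P_deg by lia. ring.
Qed.

Lemma Lam_shift lam k N : (S k < N)%nat ->
  rsum N (fun j => shiftc (P k) j * lam j) = Lam (fun j => lam (S j)) k.
Proof.
  intros H. destruct N as [|N]; [lia|]. rewrite rsum_shift. simpl shiftc.
  rewrite Lam_extend by lia. ring.
Qed.

Lemma rsum_residual (lam : nat -> R) k N : (S k < N)%nat ->
  rsum N (fun j => (shiftc (P k) j - jac_b k * P (S k) j - jac_a k * P k j
                    - prev k (fun k => P k j)) * lam j) =
  Lam (fun j => lam (S j)) k - jac_b k * Lam lam (S k) - jac_a k * Lam lam k
  - prev k (Lam lam).
Proof.
  intros H.
  rewrite (rsum_ext _ _ (fun j => 1 * (1 * (shiftc (P k) j * lam j) + - jac_b k * (P (S k) j * lam j))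
     + 1 * (- jac_a k * (P k j * lam j) + -1 * (prev k (fun k => P k j * lam j)))))
    by (intros; destruct k; simpl; ring).
  rewrite !rsum_lin, Lam_shift, !Lam_extend by lia.
  replace (rsum N (fun j => prev k (fun k => P k j * lam j))) with (prev k (Lam lam)); [ring|].
  destruct k as [|k]; simpl prev.
  - symmetry; apply rsum_zero; easy.
  - rewrite rsum_scal, Lam_extend by lia. easy.
Qed.

(** The residual has degree below [k] by the choice of [jac_a] and [jac_b], and it is orthogonal to
    all powers below [k]. A nonsingular Hankel matrix forces it to vanish. *)
Lemma three_term_coef k j :
  shiftc (P k) j - jac_b k * P (S k) j - jac_a k * P k j
  - prev k (fun k => P k j) = 0.
Proof.
  pose proof (P_lead k). pose proof (P_lead (S k)).
  set (rho := fun j => shiftc (P k) j - jac_b k * P (S k) j - jac_a k * P k j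
                       - prev k (fun k => P k j)).
  assert (Hd : forall j, (k <= j)%nat -> rho j = 0).
  { intros i Hi. unfold rho.
    replace (prev k (fun k0 => P k0 i)) with 0
      by (destruct k; simpl; [easy|rewrite P_deg by lia; ring]).
    destruct (Nat.eq_dec i k) as [->|]; [unfold jac_a; field; lra|].
    destruct (Nat.eq_dec i (S k)) as [->|].
    - simpl. rewrite (P_deg k (S k)) by lia. unfold jac_b. field; lra.
    - destruct i as [|i]; [lia|]. simpl. rewrite !P_deg by lia. ring. }
  apply (moment_nondegenerate k rho Hd).
  intros i Hi. rewrite <- (rsum_extend k (S (S k)))
    by (try lia; intros; rewrite Hd by lia; ring).
  unfold rho. rewrite (rsum_residual (fun j => st (i + j)%nat)) by lia.
  rewrite (Lam_moment_low (S k)), (Lam_moment_low k) by lia.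
  replace (fun j => st (i + S j)%nat) with (fun j => st (S i + j)%nat)
    by (extensionality x; f_equal; lia).
  destruct k as [|k]; [lia|]. simpl prev.
  (* Only the highest power leaves nonzero terms; the two of them both equal [1 / P (S k) (S k)] and
     cancel. *)
  destruct (Nat.eq_dec i k) as [->|].
  - pose proof (Lam_moment_diag (S k)). pose proof (Lam_moment_diag k).
    pose proof (P_lead k). unfold jac_b.
    apply Rmult_eq_reg_l with (P (S k) (S k)); [|lra].
    set (X := Lam (fun j => st (S k + j)%nat) (S k)) in *.
    set (Y := Lam (fun j => st (k + j)%nat) k) in *.
    replace (P (S k) (S k) * (X - P (S k) (S k) / P (S (S k)) (S (S k)) * 0 - jac_a (S k) * 0 -
       P k k / P (S k) (S k) * Y)) with (P (S k) (S k) * X - P k k * Y) by (field; lra).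
    lra.
  - rewrite !Lam_moment_low by lia. ring.
Qed.

(** Stated for an arbitrary functional on coefficients so that it serves twice: powers of [z] yield
    the recurrence of [P_k(z)], and [qmom z] yields that of [Q_k(z)]. *)
Lemma three_term lam k :
  Lam (fun j => lam (S j)) k =
  jac_b k * Lam lam (S k) + jac_a k * Lam lam k + prev k (Lam lam).
Proof.
  pose proof (rsum_residual lam k (S (S k)) ltac:(lia)) as H.
  rewrite rsum_zero in H by (intros; rewrite three_term_coef; ring). lra.
Qed.

Lemma Lam_moments k : Lam st k = if Nat.eqb k 0 then / P O O else 0.
Proof.
  destruct k as [|k]; simpl Nat.eqb; cbv iota.
  - pose proof (Lam_moment_diag O). pose proof (P_lead O).
    apply Rmult_eq_reg_l with (P O O); [|lra]. rewrite Rinv_r by lra. exact H.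
  - apply (Lam_moment_low (S k) O). lia.
Qed.

End Recurrence.

(** * The field of complex numbers *)

Declare Scope cx_scope.
Delimit Scope cx_scope with Cx.
Bind Scope cx_scope with Cx.
Local Notation "z + w" := (Cadd z w) : cx_scope.
Local Notation "z - w" := (Csub z w) : cx_scope.
Local Notation "z * w" := (Cmul z w) : cx_scope.
Local Notation "z / w" := (Cdiv z w) : cx_scope.
Local Notation "- z" := (Copp z) : cx_scope.

Lemma Cx_eq z w : Re z = Re w -> Im z = Im w -> z = w.
Proof. destruct z, w; simpl; intros -> ->; easy. Qed.

Definition Cn2 (z : Cx) : R := Re z * Re z + Im z * Im z.

Lemma Cn2_ge0 z : 0 <= Cn2 z.
Proof. unfold Cn2. nra. Qed.

Lemma Cn2_eq0 z : Cn2 z = 0 -> z = C0.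
Proof. unfold Cn2. intros H. apply Cx_eq; simpl; nra. Qed.

Lemma Cn2_pos z : z <> C0 -> 0 < Cn2 z.
Proof.
  intros H. destruct (Cn2_ge0 z) as [|E]; [easy|].
  exfalso; apply H, Cn2_eq0; easy.
Qed.

Lemma Cx_field_theory :
  field_theory C0 C1 Cadd Cmul Csub Copp Cdiv Cinv (@eq Cx).
Proof.
  split; [split| | |]; intros.
  1-8: apply Cx_eq; simpl; ring.
  - apply Cx_eq; simpl; ring.
  - intros H. apply (f_equal Re) in H. simpl in H. lra.
  - easy.
  - pose proof (Cn2_pos p H) as Hp. unfold Cn2 in Hp.
    apply Cx_eq; simpl; field; lra.
Qed.

Add Field Cx_field : Cx_field_theory.

Lemma C1_neq_C0 : C1 <> C0.
Proof. intros H. apply (f_equal Re) in H. simpl in H. lra. Qed.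

Lemma Cmul_integral z w : (z * w)%Cx = C0 -> z = C0 \/ w = C0.
Proof.
  intros H. destruct (excluded_middle_informative (z = C0)) as [|Hz]; [auto|right].
  replace w with ((z * w) / z)%Cx by (field; easy). rewrite H. field; easy.
Qed.

Lemma Csub_eq0 z w : (z - w)%Cx = C0 -> z = w.
Proof. intros H. replace z with ((z - w) + w)%Cx by ring. rewrite H. ring. Qed.

Lemma RtoC_add a b : RtoC (a + b) = (RtoC a + RtoC b)%Cx.
Proof. apply Cx_eq; simpl; ring. Qed.
Lemma RtoC_mul a b : RtoC (a * b) = (RtoC a * RtoC b)%Cx.
Proof. apply Cx_eq; simpl; ring. Qed.

Definition Cconj (z : Cx) : Cx := mkC (Re z) (- Im z).

Lemma Cconj_add z w : Cconj (z + w) = (Cconj z + Cconj w)%Cx.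
Proof. apply Cx_eq; simpl; ring. Qed.
Lemma Cconj_mul z w : Cconj (z * w) = (Cconj z * Cconj w)%Cx.
Proof. apply Cx_eq; simpl; ring. Qed.
Lemma Cconj_opp z : Cconj (- z) = (- Cconj z)%Cx.
Proof. apply Cx_eq; simpl; ring. Qed.
Lemma Cconj_real x : Cconj (RtoC x) = RtoC x.
Proof. apply Cx_eq; simpl; ring. Qed.
Lemma Cconj_pow z n : Cconj (Cpow z n) = Cpow (Cconj z) n.
Proof.
  induction n as [|n IH]; simpl; [apply Cconj_real|].
  rewrite Cconj_mul, IH; easy.
Qed.

Lemma Re_csum n u : Re (csum n u) = rsum n (fun k => Re (u k)).
Proof. induction n as [|n IH]; simpl; [easy|rewrite IH; easy]. Qed.

Lemma Im_csum n u : Im (csum n u) = rsum n (fun k => Im (u k)).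
Proof. induction n as [|n IH]; simpl; [easy|rewrite IH; easy]. Qed.

Lemma csum_ext n f g :
  (forall i, (i < n)%nat -> f i = g i) -> csum n f = csum n g.
Proof.
  induction n as [|n IH]; intros H; simpl; [easy|].
  rewrite IH by (intros; apply H; lia). rewrite H by lia. easy.
Qed.

Lemma csum_lin n a b f g :
  csum n (fun i => a * f i + b * g i)%Cx = (a * csum n f + b * csum n g)%Cx.
Proof. induction n as [|n IH]; simpl; [ring|rewrite IH; ring]. Qed.

Lemma csum_scal n a f : csum n (fun i => a * f i)%Cx = (a * csum n f)%Cx.
Proof. induction n as [|n IH]; simpl; [ring|rewrite IH; ring]. Qed.

Lemma csum_shift n f : csum (S n) f = (f O + csum n (fun i => f (S i)))%Cx.
Proof.
  induction n as [|n IH]; [simpl; ring|].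
  change (csum (S (S n)) f) with (csum (S n) f + f (S n))%Cx. rewrite IH. simpl. ring.
Qed.

Lemma Cconj_csum n f : Cconj (csum n f) = csum n (fun i => Cconj (f i)).
Proof.
  induction n as [|n IH]; simpl; [apply Cconj_real|]. rewrite Cconj_add, IH; easy.
Qed.

Lemma Cpow_real x n : Cpow (RtoC x) n = RtoC (x ^ n).
Proof.
  induction n as [|n IH]; simpl; [easy|]. rewrite IH, <- RtoC_mul. f_equal; ring.
Qed.

Lemma pevalC_real p n x : pevalC p n (RtoC x) = RtoC (pevalR p n x).
Proof.
  unfold pevalC, pevalR. induction (S n) as [|m IH]; simpl; [easy|].
  rewrite IH, Cpow_real, <- RtoC_mul, <- RtoC_add. easy.
Qed.

Lemma Cconj_pevalC p n z : Cconj (pevalC p n z) = pevalC p n (Cconj z).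
Proof.
  unfold pevalC. rewrite Cconj_csum. apply csum_ext; intros.
  rewrite Cconj_mul, Cconj_real, Cconj_pow; easy.
Qed.

(** * Christoffel-Darboux identities *)

Section Darboux.

Variables (st : nat -> R) (P : nat -> nat -> R).
Hypothesis P_deg : forall k j, (k < j)%nat -> P k j = 0.
Hypothesis P_lead : forall k, 0 < P k k.
Hypothesis P_orth : forall k m,
  rsum (S m) (fun i => P m i * Lam P (fun j => st (i + j)%nat) k) =
  if Nat.eqb k m then 1 else 0.

Definition cLam (lam : nat -> Cx) (k : nat) : Cx :=
  csum (S k) (fun j => RtoC (P k j) * lam j)%Cx.
Definition cprev (k : nat) (u : nat -> Cx) : Cx :=
  match k with O => C0 | S k => (RtoC (jac_b P k) * u k)%Cx end.

Lemma Re_cLam lam k : Re (cLam lam k) = Lam P (fun j => Re (lam j)) k.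
Proof.
  unfold cLam. rewrite Re_csum. apply rsum_ext; intros; simpl; ring.
Qed.

Lemma Im_cLam lam k : Im (cLam lam k) = Lam P (fun j => Im (lam j)) k.
Proof.
  unfold cLam. rewrite Im_csum. apply rsum_ext; intros; simpl; ring.
Qed.

Lemma cLam_lin a b f g k :
  cLam (fun j => a * f j + b * g j)%Cx k = (a * cLam f k + b * cLam g k)%Cx.
Proof.
  unfold cLam. rewrite <- csum_lin. apply csum_ext; intros; ring.
Qed.

Lemma cthree_term lam k :
  cLam (fun j => lam (S j)) k =
  (RtoC (jac_b P k) * cLam lam (S k) + RtoC (jac_a P k) * cLam lam k
   + cprev k (cLam lam))%Cx.
Proof.
  apply Cx_eq.
  - rewrite Re_cLam, (three_term st P P_deg P_lead P_orth (fun j => Re (lam j))).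
    destruct k; simpl cprev; simpl prev; unfold Cadd, Cmul, C0, RtoC; cbn [Re Im];
      rewrite !Re_cLam; ring.
  - rewrite Im_cLam, (three_term st P P_deg P_lead P_orth (fun j => Im (lam j))).
    destruct k; simpl cprev; simpl prev; unfold Cadd, Cmul, C0, RtoC; cbn [Re Im];
      rewrite !Im_cLam; ring.
Qed.

(** Jacobi recurrence with a source [tau] at index 0. The source is 0 for [P_k(z)]; for [Q_k(z)] it
    is [1 / P 0 0], the value of the moment functional on [P_0]. *)
Definition solves (z tau : Cx) (u : nat -> Cx) : Prop :=
  forall k, (z * u k + (if Nat.eqb k 0 then tau else C0) =
    RtoC (jac_b P k) * u (S k) + RtoC (jac_a P k) * u k + cprev k u)%Cx.

Definition PC (k : nat) (z : Cx) : Cx := pevalC (P k) k z.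
(* [qmom z j] is the functional applied to [(z^j - x^j) / (z - x)]. *)
Definition qmom (z : Cx) (j : nat) : Cx :=
  csum j (fun i => Cpow z i * RtoC (st (j - 1 - i)%nat))%Cx.
Definition QC (k : nat) (z : Cx) : Cx := cLam (qmom z) k.

(** From [(z^(j+1) - x^(j+1)) / (z - x) = z (z^j - x^j) / (z - x) + x^j]. *)
Lemma qmom_S z j : qmom z (S j) = (z * qmom z j + RtoC (st j))%Cx.
Proof.
  unfold qmom. rewrite csum_shift.
  replace (S j - 1 - 0)%nat with j by lia.
  rewrite (csum_ext j _ (fun i => z * (Cpow z i * RtoC (st (j - 1 - i)%nat)))%Cx).
  - rewrite csum_scal. simpl. ring.
  - intros i Hi. replace (S j - 1 - S i)%nat with (j - 1 - i)%nat by lia. simpl. ring.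
Qed.

Lemma Cconj_QC k z : Cconj (QC k z) = QC k (Cconj z).
Proof.
  unfold QC, cLam. rewrite Cconj_csum. apply csum_ext; intros j _.
  rewrite Cconj_mul, Cconj_real. f_equal. unfold qmom. rewrite Cconj_csum.
  apply csum_ext; intros i _. rewrite Cconj_mul, Cconj_real, Cconj_pow. easy.
Qed.

Lemma solves_P z : solves z C0 (fun k => PC k z).
Proof.
  intros k. pose proof (cthree_term (Cpow z) k) as H.
  change (fun k => PC k z) with (cLam (Cpow z)).
  change (PC k z) with (cLam (Cpow z) k). change (PC (S k) z) with (cLam (Cpow z) (S k)).
  rewrite <- H. simpl Cpow.
  transitivity (cLam (fun j => z * Cpow z j + C0 * Cpow z j)%Cx k).
  - rewrite cLam_lin. destruct (Nat.eqb k 0); ring.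
  - unfold cLam; apply csum_ext; intros; ring.
Qed.

Lemma solves_Q z : solves z (RtoC (/ P O O)) (fun k => QC k z).
Proof.
  intros k. pose proof (cthree_term (qmom z) k) as H.
  change (fun k => QC k z) with (cLam (qmom z)). unfold QC.
  rewrite <- H.
  transitivity (cLam (fun j => z * qmom z j + C1 * RtoC (st j))%Cx k).
  - rewrite cLam_lin. replace (cLam (fun j => RtoC (st j)) k)
      with (if Nat.eqb k 0 then RtoC (/ P O O) else C0); [ring|].
    apply Cx_eq; rewrite ?Re_cLam, ?Im_cLam; simpl.
    + rewrite (Lam_moments st P P_lead P_orth). destruct (Nat.eqb k 0); easy.
    + unfold Lam. rewrite rsum_zero by (intros; ring). destruct (Nat.eqb k 0); easy.
  - unfold cLam; apply csum_ext; intros. rewrite qmom_S. ring.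
Qed.

Lemma solves_comb z w : solves z (RtoC (/ P O O)) (fun k => w * PC k z + QC k z)%Cx.
Proof.
  intros k. pose proof (solves_P z k) as HP. pose proof (solves_Q z k) as HQ.
  transitivity (w * (z * PC k z + (if Nat.eqb k 0 then C0 else C0)) +
    (z * QC k z + (if Nat.eqb k 0 then RtoC (/ P O O) else C0)))%Cx.
  - destruct (Nat.eqb k 0); ring.
  - rewrite HP, HQ. destruct k; simpl; ring.
Qed.

(** Discrete Green formula. Multiplying each recurrence by the other solution cancels the [jac_a]
    terms, and the left-hand side grows by [(z - y) * (u n * v n)] from one index to the next. The
    sources contribute at index 0 only. *)
Lemma green z y tu tv u v n : solves z tu u -> solves y tv v ->
  (RtoC (jac_b P n) * (u (S n) * v n - u n * v (S n)) =
   (z - y) * csum (S n) (fun k => u k * v k) + (tu * v O - tv * u O))%Cx.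
Proof.
  intros Hu Hv.
  assert (Hu' : forall k, (RtoC (jac_b P k) * u (S k) = z * u k
     + (if Nat.eqb k 0 then tu else C0) - RtoC (jac_a P k) * u k - cprev k u)%Cx)
    by (intros k; rewrite (Hu k); ring).
  assert (Hv' : forall k, (RtoC (jac_b P k) * v (S k) = y * v k
     + (if Nat.eqb k 0 then tv else C0) - RtoC (jac_a P k) * v k - cprev k v)%Cx)
    by (intros k; rewrite (Hv k); ring).
  induction n as [|n IH].
  - transitivity ((RtoC (jac_b P 0) * u 1%nat) * v O - u O * (RtoC (jac_b P 0) * v 1%nat))%Cx;
      [ring|]. rewrite Hu', Hv'. simpl. ring.
  - change (csum (S (S n)) (fun k => u k * v k)%Cx)
      with (csum (S n) (fun k => u k * v k) + u (S n) * v (S n))%Cx.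
    transitivity ((RtoC (jac_b P (S n)) * u (S (S n))) * v (S n)
      - u (S n) * (RtoC (jac_b P (S n)) * v (S (S n))))%Cx; [ring|].
    rewrite Hu', Hv'. simpl Nat.eqb. cbv iota. simpl cprev.
    transitivity ((z - y) * (u (S n) * v (S n))
      + RtoC (jac_b P n) * (u (S n) * v n - u n * v (S n)))%Cx; [ring|].
    rewrite IH. ring.
Qed.

(** Partial sums of [C + w D] and, in [En], of [A + w B]. The initial constants are the [1] of [C]
    and [w] times the [-1] of [B]. *)
Definition Fn (w z : Cx) (n : nat) : Cx :=
  (C1 + z * csum (S n) (fun k => RtoC (pevalR (P k) k 0) * (w * PC k z + QC k z)))%Cx.
Definition En (w z : Cx) (n : nat) : Cx :=
  (- w + z * csum (S n) (fun k => QC k C0 * (w * PC k z + QC k z)))%Cx.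

Lemma PC_0 z : PC O z = RtoC (P O O).
Proof. unfold PC, pevalC. simpl. apply Cx_eq; simpl; ring. Qed.

Lemma QC_0 z : QC O z = C0.
Proof. unfold QC, cLam, qmom. simpl. ring. Qed.

Lemma RtoC_inv_P : (RtoC (/ P O O) * RtoC (P O O) = C1)%Cx.
Proof.
  pose proof (P_lead O). rewrite <- RtoC_mul. unfold C1. f_equal. field. lra.
Qed.

(** The partial sum is a Casoratian (discrete Wronskian) of [w P + Q] at [z] with [P] at 0. Choosing
    the second point 0 turns the factor [z - y] of the Green formula into the factor [z] of the
    Nevanlinna series. *)
Lemma Fn_green w z n :
  (Fn w z n = RtoC (jac_b P n) *
    ((w * PC (S n) z + QC (S n) z) * PC n C0 - (w * PC n z + QC n z) * PC (S n) C0))%Cx.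
Proof.
  rewrite (green z C0 _ _ (fun k => w * PC k z + QC k z)%Cx (fun k => PC k C0) n
    (solves_comb z w) (solves_P C0)).
  rewrite !PC_0, RtoC_inv_P. unfold Fn.
  rewrite (csum_ext (S n) (fun k => (w * PC k z + QC k z) * PC k C0)%Cx
    (fun k => RtoC (pevalR (P k) k 0) * (w * PC k z + QC k z))%Cx); [ring|].
  intros k _. unfold PC at 2. unfold C0 at 1. rewrite pevalC_real. ring.
Qed.

Lemma En_green w z n :
  (En w z n = RtoC (jac_b P n) *
    ((w * PC (S n) z + QC (S n) z) * QC n C0 - (w * PC n z + QC n z) * QC (S n) C0))%Cx.
Proof.
  rewrite (green z C0 _ _ (fun k => w * PC k z + QC k z)%Cx (fun k => QC k C0) n
    (solves_comb z w) (solves_Q C0)).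
  rewrite !PC_0, !QC_0. unfold En.
  transitivity (z * csum (S n) (fun k => QC k C0 * (w * PC k z + QC k z))
    - w * (RtoC (/ P O O) * RtoC (P O O)))%Cx; [rewrite RtoC_inv_P; ring|].
  rewrite (csum_ext (S n) (fun k => (w * PC k z + QC k z) * QC k C0)%Cx
    (fun k => QC k C0 * (w * PC k z + QC k z))%Cx) by (intros; ring). ring.
Qed.

(** [Fn] and [En] pair a solution with the fundamental system [P], [Q] at 0. As determinants
    multiply, the left-hand side factors into the Casoratian of that system, which is [-1], and the
    Casoratian of the two solutions, known from the Green formula. The numbers [w] and [v] are
    arbitrary. *)
Lemma darboux w z v y n :
  (Fn w z n * En v y n - En w z n * Fn v y n =
   (w - v) - (z - y) * csum (S n)
     (fun k => (w * PC k z + QC k z) * (v * PC k y + QC k y)))%Cx.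
Proof.
  assert (W : (RtoC (jac_b P n) * (PC (S n) C0 * QC n C0 - PC n C0 * QC (S n) C0) = - C1)%Cx).
  { rewrite (green C0 C0 _ _ (fun k => PC k C0) (fun k => QC k C0) n (solves_P C0) (solves_Q C0)).
    rewrite PC_0, RtoC_inv_P. ring. }
  pose proof (green z y _ _ _ _ n (solves_comb z w) (solves_comb y v)) as G.
  cbv beta in G. rewrite !PC_0, !QC_0 in G.
  rewrite !Fn_green, !En_green.
  transitivity ((RtoC (jac_b P n) * (PC (S n) C0 * QC n C0 - PC n C0 * QC (S n) C0)) *
    (RtoC (jac_b P n) * ((w * PC (S n) z + QC (S n) z) * (v * PC n y + QC n y) -
       (w * PC n z + QC n z) * (v * PC (S n) y + QC (S n) y))))%Cx; [ring|].
  rewrite W, G.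
  transitivity (- ((z - y) * csum (S n)
     (fun k => (w * PC k z + QC k z) * (v * PC k y + QC k y)) +
     (v - w) * (RtoC (/ P O O) * RtoC (P O O))))%Cx; [ring|].
  rewrite RtoC_inv_P. ring.
Qed.

Lemma Cconj_Fn w z n : Cconj (Fn w z n) = Fn (Cconj w) (Cconj z) n.
Proof.
  unfold Fn. rewrite Cconj_add, Cconj_mul, Cconj_csum. unfold C1. rewrite Cconj_real.
  do 2 f_equal. apply csum_ext; intros k _. unfold PC.
  rewrite !Cconj_mul, Cconj_add, Cconj_mul, Cconj_real, Cconj_QC, Cconj_pevalC. easy.
Qed.

Lemma Cconj_En w z n : Cconj (En w z n) = En (Cconj w) (Cconj z) n.
Proof.
  unfold En. rewrite Cconj_add, Cconj_mul, Cconj_csum, Cconj_opp.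
  do 2 f_equal. apply csum_ext; intros k _. unfold PC.
  rewrite !Cconj_mul, Cconj_add, Cconj_mul, !Cconj_QC, Cconj_pevalC.
  unfold C0. rewrite Cconj_real. easy.
Qed.

End Darboux.

(** * Bessel form and resolvents *)

Lemma quadratic_discr X Y m : 0 <= Y ->
  (forall t, 0 <= X + 2 * t * m + t * t * Y) -> m * m <= X * Y.
Proof.
  intros HY H. destruct (Rle_lt_or_eq_dec 0 Y HY) as [Hp|He].
  - specialize (H (- m / Y)).
    replace (X + 2 * (- m / Y) * m + - m / Y * (- m / Y) * Y) with ((X * Y - m * m) / Y)
      in H by (field; lra).
    assert (0 <= (X * Y - m * m) / Y * Y) by nra.
    replace ((X * Y - m * m) / Y * Y) with (X * Y - m * m) in H0 by (field; lra). lra.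
  - rewrite <- He in *. destruct (Req_dec m 0) as [->|Hm]; [lra|].
    (* With [Y = 0] the expression is affine in [t], and this [t] gives it the value [-1]. *)
    specialize (H (- (X + 1) / (2 * m))).
    replace (X + 2 * (- (X + 1) / (2 * m)) * m +
      - (X + 1) / (2 * m) * (- (X + 1) / (2 * m)) * 0) with (-1) in H by (field; lra). lra.
Qed.

Lemma rsum_delta n k m : (k < n)%nat ->
  rsum n (fun l => m l * (if Nat.eqb k l then 1 else 0)) = m k.
Proof.
  induction n as [|n IH]; intros H; [lia|]. simpl.
  destruct (Nat.eq_dec k n) as [->|Hk].
  - rewrite Nat.eqb_refl, rsum_zero; [ring|]. intros i Hi.
    replace (Nat.eqb n i) with false by (symmetry; apply Nat.eqb_neq; lia). ring.
  - rewrite IH by lia. replace (Nat.eqb k n) with false by (symmetry; apply Nat.eqb_neq; lia).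
    ring.
Qed.

(** [u] is the difference of [u + v] and [v], two series of nonnegative terms with bounded partial
    sums. *)
Lemma rsum_abs_cv u v M : (forall k, Rabs (u k) <= v k) ->
  (forall n, rsum n v <= M) -> exists l, Un_cv (fun n => rsum (S n) u) l.
Proof.
  intros Huv HM.
  assert (Inc : forall a : nat -> R, (forall k, 0 <= a k) ->
    (exists K, forall n, rsum n a <= K) -> exists l, Un_cv (fun n => rsum (S n) a) l).
  { intros a Ha [K HK]. destruct (growing_cv (fun n => rsum (S n) a)) as [l Hl].
    - intros n. simpl. specialize (Ha (S n)). lra.
    - exists K. intros x [n ->]. apply HK.
    - exists l; easy. }
  assert (Hv : forall k, 0 <= u k + v k <= 2 * v k).
  { intros k. specialize (Huv k). revert Huv. unfold Rabs; destruct Rcase_abs; lra. }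
  destruct (Inc (fun k => 1 * u k + 1 * v k)) as [l Hl].
  - intros k. specialize (Hv k). lra.
  - exists (2 * M). intros n. apply Rle_trans with (rsum n (fun k => 2 * v k)).
    + apply rsum_le; intros i _. specialize (Hv i). lra.
    + rewrite rsum_scal. specialize (HM n). lra.
  - destruct (Inc v) as [l' Hl'].
    + intros k. specialize (Huv k). pose proof (Rabs_pos (u k)). lra.
    + exists M; easy.
    + exists (l - l'). intros eps He.
      destruct (CV_minus _ _ _ _ Hl Hl' eps He) as [N HN]. exists N. intros n Hn.
      specialize (HN n Hn). rewrite rsum_lin in HN.
      replace (1 * rsum (S n) u + 1 * rsum (S n) v - rsum (S n) v) with (rsum (S n) u) in HN
        by ring. easy.
Qed.

(** * Cauchy kernels *)

Definition cauchy_kernel (z : Cx) (t : R) : Cx := Cinv (RtoC t - z).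

Lemma kernel_denominator z t : Im z <> 0 -> (RtoC t - z)%Cx <> C0.
Proof. intros Hz H. apply (f_equal Im) in H. simpl in H. lra. Qed.

Lemma Im_sqr_pos z : Im z <> 0 -> 0 < Im z * Im z.
Proof. intros H. pose proof (Rsqr_pos_lt _ H) as H0. exact H0. Qed.

Lemma kernel_Cn2_le z t : Im z <> 0 -> Cn2 (cauchy_kernel z t) <= / (Im z * Im z).
Proof.
  intros Hz. pose proof (Im_sqr_pos z Hz). unfold cauchy_kernel, Cn2, Cinv. simpl.
  set (n := (t + - Re z) * (t + - Re z) + (0 + - Im z) * (0 + - Im z)).
  assert (Hn : Im z * Im z <= n)
    by (unfold n; pose proof (Rle_0_sqr (t + - Re z)) as Q; unfold Rsqr in Q; lra).
  replace ((t + - Re z) / n * ((t + - Re z) / n) + - (0 + - Im z) / n * (- (0 + - Im z) / n))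
    with (n * (/ n * / n)) by (unfold Rdiv; unfold n at 1; ring).
  replace (n * (/ n * / n)) with (/ n) by (field; lra).
  apply Rinv_le_contravar; lra.
Qed.

Lemma abs_le_of_sqr x y : x * x <= y -> Rabs x <= y + 1.
Proof. intros H. unfold Rabs; destruct Rcase_abs; nra. Qed.

Lemma kernel_good z : Im z <> 0 ->
  good (fun t => Re (cauchy_kernel z t)) /\ good (fun t => Im (cauchy_kernel z t)).
Proof.
  intros Hz. pose proof (Im_sqr_pos z Hz).
  assert (Hn : forall t, (t + - Re z) * (t + - Re z) + (0 + - Im z) * (0 + - Im z) <> 0)
    by (intros t; pose proof (Rle_0_sqr (t + - Re z)) as Q; unfold Rsqr in Q; lra).
  split; apply good_bounded with (/ (Im z * Im z) + 1).
  - apply (continuity_div (fun t => t + - Re z)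
      (fun t => (t + - Re z) * (t + - Re z) + (0 + - Im z) * (0 + - Im z))); auto;
      intros t; reg.
  - intros t. apply abs_le_of_sqr. pose proof (kernel_Cn2_le z t Hz). unfold Cn2 in H0.
    set (a := Im (cauchy_kernel z t)) in *. nra.
  - apply (continuity_div (fun t => - (0 + - Im z))
      (fun t => (t + - Re z) * (t + - Re z) + (0 + - Im z) * (0 + - Im z))); auto;
      intros t; reg.
  - intros t. apply abs_le_of_sqr. pose proof (kernel_Cn2_le z t Hz). unfold Cn2 in H0.
    set (a := Re (cauchy_kernel z t)) in *. nra.
Qed.

Lemma kernel_conj z t : cauchy_kernel (Cconj z) t = Cconj (cauchy_kernel z t).
Proof.
  apply Cx_eq; unfold cauchy_kernel, Cinv; simpl;
  replace ((t + - Re z) * (t + - Re z) + (0 + - - Im z) * (0 + - - Im z))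
    with ((t + - Re z) * (t + - Re z) + (0 + - Im z) * (0 + - Im z)) by ring;
  unfold Rdiv; ring.
Qed.

Lemma kernel_resolvent z y t : Im z <> 0 -> Im y <> 0 ->
  (cauchy_kernel z t - cauchy_kernel y t =
   (z - y) * (cauchy_kernel z t * cauchy_kernel y t))%Cx.
Proof.
  intros Hz Hy. unfold cauchy_kernel. field.
  split; apply kernel_denominator; easy.
Qed.

Definition cgood (f : R -> Cx) : Prop :=
  good (fun t => Re (f t)) /\ good (fun t => Im (f t)).

Lemma cgood_lin a b f g : cgood f -> cgood g -> cgood (fun t => a * f t + b * g t)%Cx.
Proof.
  intros [F1 F2] [G1 G2]. split; simpl.
  - apply (good_plus (fun t => Re a * Re (f t) - Im a * Im (f t))
      (fun t => Re b * Re (g t) - Im b * Im (g t)));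
    [replace (fun t => Re a * Re (f t) - Im a * Im (f t))
       with (fun t => Re a * Re (f t) + - Im a * Im (f t)) by (extensionality t; ring)
    |replace (fun t => Re b * Re (g t) - Im b * Im (g t))
       with (fun t => Re b * Re (g t) + - Im b * Im (g t)) by (extensionality t; ring)];
    apply good_lin; auto.
  - apply (good_plus (fun t => Re a * Im (f t) + Im a * Re (f t))
      (fun t => Re b * Im (g t) + Im b * Re (g t))); apply good_lin; auto.
Qed.

Lemma cgood_mult f g : cgood f -> cgood g -> cgood (fun t => f t * g t)%Cx.
Proof.
  intros [F1 F2] [G1 G2]. split; simpl.
  - replace (fun t => Re (f t) * Re (g t) - Im (f t) * Im (g t))
      with (fun t => 1 * (Re (f t) * Re (g t)) + -1 * (Im (f t) * Im (g t)))
      by (extensionality t; ring).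
    apply good_lin; apply good_mult; auto.
  - apply good_plus; apply good_mult; auto.
Qed.

Lemma cgood_real f : good f -> cgood (fun t => RtoC (f t)).
Proof. intros H. split; simpl; [easy|apply good_const]. Qed.

Section Bessel.

Variables (mu : (R -> R) -> R) (st : nat -> R) (P : nat -> nat -> R).
Hypothesis Hmu : positive_functional mu.
Hypothesis mu_moment : forall k, mu (fun x => x ^ k) = st k.
Hypothesis P_deg : forall k j, (k < j)%nat -> P k j = 0.
Hypothesis P_lead : forall k, 0 < P k k.
Hypothesis P_orth : forall k m,
  rsum (S m) (fun i => P m i * Lam P (fun j => st (i + j)%nat) k) =
  if Nat.eqb k m then 1 else 0.

Let Pk (k : nat) : R -> R := pevalR (P k) k.

Definition bessel (n : nat) (f h : R -> R) : R :=
  mu (fun t => f t * h t)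
  - rsum (S n) (fun k => mu (fun t => f t * Pk k t) * mu (fun t => h t * Pk k t)).

Lemma bessel_sym n f h : bessel n f h = bessel n h f.
Proof.
  unfold bessel. f_equal.
  - apply functional_ext; intros; ring.
  - apply rsum_ext; intros; ring.
Qed.

Lemma bessel_lin n a b f g h : good f -> good g -> good h ->
  bessel n (fun t => a * f t + b * g t) h = a * bessel n f h + b * bessel n g h.
Proof.
  intros Hf Hg Hh. unfold bessel.
  assert (L : forall p, good p -> mu (fun t => (a * f t + b * g t) * p t) =
     a * mu (fun t => f t * p t) + b * mu (fun t => g t * p t)).
  { intros p Hp. rewrite <- (pf_lin _ Hmu) by (apply good_mult; auto).
    apply functional_ext; intros; ring. }
  rewrite L by easy.
  rewrite (rsum_ext _ _ (fun k => a * (mu (fun t => f t * Pk k t) * mu (fun t => h t * Pk k t))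
    + b * (mu (fun t => g t * Pk k t) * mu (fun t => h t * Pk k t)))).
  - rewrite rsum_lin. ring.
  - intros k _. rewrite L by apply good_pevalR. ring.
Qed.

Lemma mu_orth k m : mu (fun t => Pk k t * Pk m t) = if Nat.eqb k m then 1 else 0.
Proof.
  rewrite <- P_orth. transitivity (mu (fun t => Pk m t * Pk k t)).
  - apply functional_ext; intros; ring.
  - apply (pf_pevalR_pevalR mu Hmu st); easy.
Qed.

(** The value is [mu ((f - p)^2)], where [p] is the projection of [f] onto the span of
    [P_0, ..., P_n]. *)
Lemma bessel_ge0 n f : good f -> 0 <= bessel n f f.
Proof.
  intros Hf. set (m := fun k => mu (fun t => f t * Pk k t)).
  set (p := fun t => rsum (S n) (fun k => m k * Pk k t)).
  assert (Gk : forall k, good (Pk k)) by (intros; apply good_pevalR).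
  assert (Hp : good p).
  { apply (good_rsum (S n) (fun k t => m k * Pk k t)). intros; apply good_scal; auto. }
  assert (Mp : forall h, good h -> mu (fun t => h t * p t) =
     rsum (S n) (fun k => m k * mu (fun t => h t * Pk k t))).
  { intros h Hh. rewrite <- (pf_rsum mu Hmu (S n) m (fun k t => h t * Pk k t))
      by (intros; apply good_mult; auto).
    apply functional_ext; intros t. unfold p. rewrite <- rsum_scal.
    apply rsum_ext; intros; ring. }
  assert (Hfp : mu (fun t => f t * p t) = rsum (S n) (fun k => m k * m k)) by (apply Mp; auto).
  assert (Hpp : mu (fun t => p t * p t) = rsum (S n) (fun k => m k * m k)).
  { rewrite Mp by easy. apply rsum_ext; intros k Hk. f_equal.
    transitivity (mu (fun t => Pk k t * p t)); [apply functional_ext; intros; ring|].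
    rewrite Mp by auto.
    rewrite <- (rsum_delta (S n) k m Hk). apply rsum_ext; intros l _.
    rewrite mu_orth. easy. }
  assert (H : 0 <= mu (fun t => (f t - p t) * (f t - p t))).
  { apply (pf_ge0 _ Hmu).
    - assert (G : good (fun t => 1 * f t + -1 * p t)) by (apply good_lin; auto).
      replace (fun t => (f t - p t) * (f t - p t))
        with (fun t => (1 * f t + -1 * p t) * (1 * f t + -1 * p t))
        by (extensionality t; ring).
      apply good_mult; auto.
    - intros t. apply Rle_0_sqr. }
  replace (mu (fun t => (f t - p t) * (f t - p t)))
    with (1 * mu (fun t => 1 * (f t * f t) + -2 * (f t * p t)) + 1 * mu (fun t => p t * p t)) in H.
  - rewrite (pf_lin _ Hmu) in H by (apply good_mult; auto).
    rewrite Hfp, Hpp in H. unfold bessel. fold m.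
    change (rsum (S n) (fun k => mu (fun t => f t * Pk k t) * mu (fun t => f t * Pk k t)))
      with (rsum (S n) (fun k => m k * m k)). lra.
  - rewrite <- (pf_lin _ Hmu).
    + apply functional_ext; intros; ring.
    + apply good_lin; apply good_mult; auto.
    + apply good_mult; auto.
Qed.

Lemma bessel_le n f : bessel n f f <= mu (fun t => f t * f t).
Proof.
  unfold bessel.
  assert (0 <= rsum (S n) (fun k => mu (fun t => f t * Pk k t) * mu (fun t => f t * Pk k t))).
  { rewrite <- (rsum_zero (S n) (fun _ => 0)) by easy. apply rsum_le. intros; apply Rle_0_sqr. }
  lra.
Qed.

Lemma bessel_cauchy_schwarz n f h : good f -> good h ->
  bessel n f h * bessel n f h <= bessel n f f * bessel n h h.
Proof.
  intros Hf Hh. apply quadratic_discr; [apply bessel_ge0; auto|].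
  intros t.
  replace (bessel n f f + 2 * t * bessel n f h + t * t * bessel n h h)
    with (bessel n (fun x => 1 * f x + t * h x) (fun x => 1 * f x + t * h x)).
  - apply bessel_ge0, good_lin; auto.
  - rewrite bessel_lin by (auto using good_lin).
    rewrite (bessel_sym n f (fun x => 1 * f x + t * h x)),
      (bessel_sym n h (fun x => 1 * f x + t * h x)).
    rewrite !bessel_lin by auto. rewrite (bessel_sym n h f). ring.
Qed.

Definition cmu (f : R -> Cx) : Cx := mkC (mu (fun t => Re (f t))) (mu (fun t => Im (f t))).

Lemma cmu_ext f g : (forall t, f t = g t) -> cmu f = cmu g.
Proof. intros H. f_equal. extensionality t. apply H. Qed.

Lemma cmu_lin a b f g : cgood f -> cgood g ->
  cmu (fun t => a * f t + b * g t)%Cx = (a * cmu f + b * cmu g)%Cx.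
Proof.
  intros [F1 F2] [G1 G2]. unfold cmu. apply Cx_eq; simpl.
  - transitivity (1 * (Re a * mu (fun t => Re (f t)) + - Im a * mu (fun t => Im (f t)))
     + 1 * (Re b * mu (fun t => Re (g t)) + - Im b * mu (fun t => Im (g t)))); [|ring].
    rewrite <- !(pf_lin _ Hmu) by (auto using good_lin).
    apply functional_ext; intros; ring.
  - transitivity (1 * (Re a * mu (fun t => Im (f t)) + Im a * mu (fun t => Re (f t)))
     + 1 * (Re b * mu (fun t => Im (g t)) + Im b * mu (fun t => Re (g t)))); [|ring].
    rewrite <- !(pf_lin _ Hmu) by (auto using good_lin).
    apply functional_ext; intros; ring.
Qed.

(** Bilinear, not Hermitian, to match the Darboux formula, which contains no conjugates. Conjugation
    enters later through the kernel at [Cconj z]. *)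
Definition cbessel (n : nat) (f h : R -> Cx) : Cx :=
  (cmu (fun t => f t * h t) - csum (S n)
    (fun k => cmu (fun t => f t * RtoC (Pk k t)) * cmu (fun t => h t * RtoC (Pk k t))))%Cx.

Lemma cbessel_parts n f h : cgood f -> cgood h ->
  Re (cbessel n f h) = bessel n (fun t => Re (f t)) (fun t => Re (h t))
                     - bessel n (fun t => Im (f t)) (fun t => Im (h t)) /\
  Im (cbessel n f h) = bessel n (fun t => Re (f t)) (fun t => Im (h t))
                     + bessel n (fun t => Im (f t)) (fun t => Re (h t)).
Proof.
  intros [F1 F2] [H1 H2].
  assert (R1 : forall (g : R -> Cx) k, mu (fun t => Re (g t * RtoC (Pk k t)))
     = mu (fun t => Re (g t) * Pk k t)) by (intros; apply functional_ext; intros; simpl; ring).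
  assert (R2 : forall (g : R -> Cx) k, mu (fun t => Im (g t * RtoC (Pk k t)))
     = mu (fun t => Im (g t) * Pk k t)) by (intros; apply functional_ext; intros; simpl; ring).
  unfold cbessel, Csub, Cadd, Copp. cbn [Re Im]. rewrite Re_csum, Im_csum.
  unfold bessel. split.
  - rewrite (rsum_ext (S n) _ (fun k =>
      1 * (mu (fun t => Re (f t) * Pk k t) * mu (fun t => Re (h t) * Pk k t))
      + -1 * (mu (fun t => Im (f t) * Pk k t) * mu (fun t => Im (h t) * Pk k t)))).
    2:{ intros k _. unfold cmu, Cmul at 1. cbn [Re Im]. rewrite !R1, !R2. ring. }
    rewrite rsum_lin. unfold cmu. cbn [Re].
    replace (mu (fun t => Re (f t * h t))) with
      (1 * mu (fun t => Re (f t) * Re (h t)) + -1 * mu (fun t => Im (f t) * Im (h t))); [ring|].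
    rewrite <- (pf_lin _ Hmu) by (apply good_mult; auto).
    apply functional_ext; intros; simpl; ring.
  - rewrite (rsum_ext (S n) _ (fun k =>
      1 * (mu (fun t => Re (f t) * Pk k t) * mu (fun t => Im (h t) * Pk k t))
      + 1 * (mu (fun t => Im (f t) * Pk k t) * mu (fun t => Re (h t) * Pk k t)))).
    2:{ intros k _. unfold cmu, Cmul at 1. cbn [Re Im]. rewrite !R1, !R2. ring. }
    rewrite rsum_lin. unfold cmu. cbn [Im].
    replace (mu (fun t => Im (f t * h t))) with
      (1 * mu (fun t => Re (f t) * Im (h t)) + 1 * mu (fun t => Im (f t) * Re (h t))); [ring|].
    rewrite <- (pf_lin _ Hmu) by (apply good_mult; auto).
    apply functional_ext; intros; simpl; ring.
Qed.

Definition bessel_norm (n : nat) (f : R -> Cx) : R :=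
  bessel n (fun t => Re (f t)) (fun t => Re (f t))
  + bessel n (fun t => Im (f t)) (fun t => Im (f t)).

(** Real Cauchy-Schwarz for the four pairs of real and imaginary parts. The factor 4 is not sharp,
    but later uses need only the vanishing of a norm or the order of a bound. *)
Lemma cbessel_cauchy_schwarz n f h : cgood f -> cgood h ->
  Cn2 (cbessel n f h) <= 4 * (bessel_norm n f * bessel_norm n h).
Proof.
  intros Hf Hh. destruct (cbessel_parts n f h Hf Hh) as [E1 E2].
  destruct Hf as [F1 F2], Hh as [H1 H2].
  unfold Cn2, bessel_norm. rewrite E1, E2.
  pose proof (bessel_cauchy_schwarz n _ _ F1 H1).
  pose proof (bessel_cauchy_schwarz n _ _ F1 H2).
  pose proof (bessel_cauchy_schwarz n _ _ F2 H1).
  pose proof (bessel_cauchy_schwarz n _ _ F2 H2).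
  pose proof (bessel_ge0 n _ F1). pose proof (bessel_ge0 n _ F2).
  pose proof (bessel_ge0 n _ H1). pose proof (bessel_ge0 n _ H2).
  set (a := bessel n (fun t => Re (f t)) (fun t => Re (f t))) in *.
  set (b := bessel n (fun t => Im (f t)) (fun t => Im (f t))) in *.
  set (c := bessel n (fun t => Re (h t)) (fun t => Re (h t))) in *.
  set (d := bessel n (fun t => Im (h t)) (fun t => Im (h t))) in *.
  set (p := bessel n (fun t => Re (f t)) (fun t => Re (h t))) in *.
  set (q := bessel n (fun t => Re (f t)) (fun t => Im (h t))) in *.
  set (r := bessel n (fun t => Im (f t)) (fun t => Re (h t))) in *.
  set (v := bessel n (fun t => Im (f t)) (fun t => Im (h t))) in *.
  apply Rle_trans with (2 * (p * p + q * q + r * r + v * v)).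
  - pose proof (Rle_0_sqr (p + v)). pose proof (Rle_0_sqr (q - r)). unfold Rsqr in *. lra.
  - assert (0 <= a * c) by nra. assert (0 <= a * d) by nra.
    assert (0 <= b * c) by nra. assert (0 <= b * d) by nra. lra.
Qed.

(** Dropping the subtracted squares only increases the norm, so the bound does not depend on [n]. *)
Lemma bessel_norm_le n f M : cgood f -> (forall t, Cn2 (f t) <= M) ->
  bessel_norm n f <= M * mu (fun _ => 1).
Proof.
  intros [F1 F2] HM. unfold bessel_norm.
  pose proof (bessel_le n (fun t => Re (f t))).
  pose proof (bessel_le n (fun t => Im (f t))).
  assert (G1 : good (fun t => Re (f t) * Re (f t))) by (apply good_mult; auto).
  assert (G2 : good (fun t => Im (f t) * Im (f t))) by (apply good_mult; auto).
  assert (0 <= mu (fun t => 1 * (M * 1 + -1 * (Re (f t) * Re (f t))) + -1 * (Im (f t) * Im (f t)))).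
  { apply (pf_ge0 _ Hmu).
    - apply good_lin; auto. apply (good_lin M (-1) (fun _ => 1)); auto using good_const.
    - intros t. specialize (HM t). unfold Cn2 in HM. lra. }
  rewrite (pf_lin _ Hmu) in H1; auto.
  2:{ apply (good_lin M (-1) (fun _ => 1)); auto using good_const. }
  rewrite (pf_lin _ Hmu M (-1) (fun _ => 1)) in H1; auto using good_const. lra.
Qed.

(** Products of coefficients are dominated by sums of squares, which Bessel's inequality bounds. The
    limit thus exists for equal kernels too, where the Darboux formula has the factor
    [z - y = 0]. *)
Lemma cbessel_cv f h : cgood f -> cgood h -> exists l,
  Un_cv (fun n => Re (cbessel n f h)) (Re l) /\ Un_cv (fun n => Im (cbessel n f h)) (Im l).
Proof.
  intros Hf Hh.
  assert (B : forall p q, good p -> good q -> exists l, Un_cv (fun n => bessel n p q) l).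
  { intros p q Hp Hq.
    destruct (rsum_abs_cv
      (fun k => mu (fun t => p t * Pk k t) * mu (fun t => q t * Pk k t))
      (fun k => 1 * (mu (fun t => p t * Pk k t) * mu (fun t => p t * Pk k t))
              + 1 * (mu (fun t => q t * Pk k t) * mu (fun t => q t * Pk k t)))
      (mu (fun t => p t * p t) + mu (fun t => q t * q t))) as [l Hl].
    - intros k. set (x := mu (fun t => p t * Pk k t)). set (y := mu (fun t => q t * Pk k t)).
      apply Rabs_le. nra.
    - intros n. rewrite rsum_lin.
      pose proof (bessel_ge0 n p Hp). pose proof (bessel_ge0 n q Hq).
      unfold bessel in *. simpl in H, H0.
      set (x := mu (fun t => p t * Pk n t)) in *. set (y := mu (fun t => q t * Pk n t)) in *.
      nra.
    - exists (mu (fun t => p t * q t) - l). unfold bessel.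
      apply (CV_minus (fun _ => mu (fun t => p t * q t))); [|easy].
      intros eps He. exists O. intros n _. rewrite Rdist_eq. easy. }
  destruct Hf as [F1 F2], Hh as [H1 H2].
  destruct (B _ _ F1 H1) as [a Ha], (B _ _ F2 H2) as [b Hb],
    (B _ _ F1 H2) as [c Hc], (B _ _ F2 H1) as [d Hd].
  exists (mkC (a - b) (c + d)). cbn [Re Im]. split.
  - apply Un_cv_ext with (fun n => bessel n (fun t => Re (f t)) (fun t => Re (h t))
      - bessel n (fun t => Im (f t)) (fun t => Im (h t))).
    + intros n. symmetry. apply cbessel_parts; split; auto.
    + apply CV_minus; auto.
  - apply Un_cv_ext with (fun n => bessel n (fun t => Re (f t)) (fun t => Im (h t))
      + bessel n (fun t => Im (f t)) (fun t => Re (h t))).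
    + intros n. symmetry. apply cbessel_parts; split; auto.
    + apply CV_plus; auto.
Qed.

Lemma cbessel_lin n a b f g h : cgood f -> cgood g -> cgood h ->
  cbessel n (fun t => a * f t + b * g t)%Cx h = (a * cbessel n f h + b * cbessel n g h)%Cx.
Proof.
  intros Hf Hg Hh. unfold cbessel.
  assert (L : forall p, cgood p -> cmu (fun t => (a * f t + b * g t) * p t)%Cx =
     (a * cmu (fun t => f t * p t) + b * cmu (fun t => g t * p t))%Cx).
  { intros p Hp. rewrite <- cmu_lin by (apply cgood_mult; auto).
    apply cmu_ext; intros; ring. }
  rewrite L by easy.
  rewrite (csum_ext _ _ (fun k => a * (cmu (fun t => f t * RtoC (Pk k t)) * cmu (fun t => h t * RtoC (Pk k t)))
    + b * (cmu (fun t => g t * RtoC (Pk k t)) * cmu (fun t => h t * RtoC (Pk k t))))%Cx).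
  - rewrite csum_lin. ring.
  - intros k _. rewrite (L (fun t => RtoC (Pk k t))) by apply cgood_real, good_pevalR. ring.
Qed.

(** * Stieltjes transform of the functional and its Darboux formula *)

Definition weyl (z : Cx) : Cx := cmu (cauchy_kernel z).

Lemma weyl_conj z : Im z <> 0 -> weyl (Cconj z) = Cconj (weyl z).
Proof.
  intros Hz. unfold weyl, cmu, Cconj. cbn [Re Im]. f_equal.
  - apply functional_ext; intros. change (mkC (Re z) (- Im z)) with (Cconj z).
    rewrite kernel_conj. easy.
  - transitivity (mu (fun t => -1 * Im (cauchy_kernel z t))).
    + apply functional_ext; intros. change (mkC (Re z) (- Im z)) with (Cconj z).
      rewrite kernel_conj. simpl. ring.
    + rewrite (pf_scal mu Hmu) by (apply kernel_good; easy). ring.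
Qed.

(** The identity [t / (t - z) = 1 + z / (t - z)] gives the recursion of [qmom_S], now with initial
    value [weyl z]. *)
Lemma cmu_kernel_pow z j : Im z <> 0 ->
  cmu (fun t => cauchy_kernel z t * RtoC (t ^ j))%Cx
  = (weyl z * Cpow z j + qmom st z j)%Cx.
Proof.
  intros Hz. induction j as [|j IH].
  - unfold qmom, weyl. simpl.
    transitivity (cmu (cauchy_kernel z)); [|ring].
    apply cmu_ext; intros t. change (RtoC 1) with C1. ring.
  - rewrite qmom_S. simpl Cpow.
    transitivity (cmu (fun t => z * (cauchy_kernel z t * RtoC (t ^ j)) + C1 * RtoC (t ^ j))%Cx).
    + apply cmu_ext; intros t. unfold cauchy_kernel. simpl pow. rewrite RtoC_mul.
      field. apply kernel_denominator; easy.
    + rewrite cmu_lin, IH.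
      * replace (cmu (fun t => RtoC (t ^ j))) with (RtoC (st j)); [ring|].
        rewrite <- mu_moment. unfold cmu, RtoC. cbn [Re Im]. f_equal.
        transitivity (mu (fun t => 0 * 1)); [|apply functional_ext; intros; ring].
        rewrite (pf_scal mu Hmu 0 (fun _ => 1)) by apply good_const. ring.
      * apply cgood_mult; [apply kernel_good; easy|]. apply cgood_real, good_pow.
      * apply cgood_real, good_pow.
Qed.

Lemma cmu_kernel_P z k : Im z <> 0 ->
  cmu (fun t => cauchy_kernel z t * RtoC (Pk k t))%Cx
  = (weyl z * PC P k z + QC st P k z)%Cx.
Proof.
  intros Hz.
  transitivity (cLam P (fun j => weyl z * Cpow z j + C1 * qmom st z j)%Cx k).
  - apply Cx_eq; rewrite ?Re_cLam, ?Im_cLam; unfold cmu; cbn [Re Im].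
    + transitivity (mu (fun t => Pk k t * Re (cauchy_kernel z t))).
      { apply functional_ext; intros; simpl; ring. }
      unfold Pk. rewrite (pf_pevalR_mult mu Hmu) by (apply kernel_good; easy).
      unfold Lam. apply rsum_ext; intros j _. f_equal.
      transitivity (Re (cmu (fun t => cauchy_kernel z t * RtoC (t ^ j))%Cx)).
      * unfold cmu; cbn [Re]. apply functional_ext; intros; simpl; ring.
      * rewrite cmu_kernel_pow by easy. simpl. ring.
    + transitivity (mu (fun t => Pk k t * Im (cauchy_kernel z t))).
      { apply functional_ext; intros; simpl; ring. }
      unfold Pk. rewrite (pf_pevalR_mult mu Hmu) by (apply kernel_good; easy).
      unfold Lam. apply rsum_ext; intros j _. f_equal.
      transitivity (Im (cmu (fun t => cauchy_kernel z t * RtoC (t ^ j))%Cx)).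
      * unfold cmu; cbn [Im]. apply functional_ext; intros; simpl; ring.
      * rewrite cmu_kernel_pow by easy. simpl. ring.
  - rewrite cLam_lin. unfold PC, pevalC, QC, cLam. ring.
Qed.

Lemma darboux_bessel n z y : Im z <> 0 -> Im y <> 0 ->
  ((z - y) * cbessel n (cauchy_kernel z) (cauchy_kernel y) =
   Fn st P (weyl z) z n * En st P (weyl y) y n - En st P (weyl z) z n * Fn st P (weyl y) y n)%Cx.
Proof.
  intros Hz Hy. rewrite (darboux st P P_deg P_lead P_orth).
  unfold cbessel.
  rewrite (csum_ext (S n) _ (fun k => (weyl z * PC P k z + QC st P k z) *
    (weyl y * PC P k y + QC st P k y))%Cx)
    by (intros; rewrite !cmu_kernel_P by easy; easy).
  (* The resolvent identity under [mu]. As [cmu_lin] takes two terms, a second one with factor [C0]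
     is added. *)
  assert (H : ((z - y) * cmu (fun t => cauchy_kernel z t * cauchy_kernel y t) = weyl z - weyl y)%Cx).
  { assert (G : cgood (fun t => cauchy_kernel z t * cauchy_kernel y t)%Cx)
      by (apply cgood_mult; apply kernel_good; easy).
    transitivity (cmu (fun t => (z - y) * (cauchy_kernel z t * cauchy_kernel y t)
      + C0 * (cauchy_kernel z t * cauchy_kernel y t))%Cx).
    - rewrite cmu_lin by easy. ring.
    - transitivity (cmu (fun t => C1 * cauchy_kernel z t + - C1 * cauchy_kernel y t)%Cx).
      + apply cmu_ext; intros t. rewrite <- kernel_resolvent by easy. ring.
      + rewrite cmu_lin by (apply kernel_good; easy). unfold weyl. ring. }
  rewrite <- H. ring.
Qed.

(** The kernel at [Cconj z] is the conjugate kernel, which turns the bilinear form into a Hermitian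
    square. *)
Lemma cbessel_kernel_conj n z : Im z <> 0 ->
  cbessel n (cauchy_kernel z) (cauchy_kernel (Cconj z))
  = RtoC (bessel_norm n (cauchy_kernel z)).
Proof.
  intros Hz. pose proof (kernel_good z Hz) as [G1 G2].
  assert (Hz' : Im (Cconj z) <> 0) by (simpl; lra).
  assert (N : forall f, good f -> bessel n f (fun t => Im (cauchy_kernel (Cconj z) t)) =
     - bessel n f (fun t => Im (cauchy_kernel z t))).
  { intros f Hf. rewrite (bessel_sym n f), (bessel_sym n f).
    transitivity (bessel n (fun t => -1 * Im (cauchy_kernel z t) + 0 * Im (cauchy_kernel z t)) f).
    - f_equal. extensionality t. rewrite kernel_conj. simpl. ring.
    - rewrite bessel_lin by easy. ring. }
  assert (E : (fun t => Re (cauchy_kernel (Cconj z) t)) = (fun t => Re (cauchy_kernel z t)))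
    by (extensionality t; rewrite kernel_conj; easy).
  destruct (cbessel_parts n (cauchy_kernel z) (cauchy_kernel (Cconj z)))
    as [H1 H2]; [split; easy|apply kernel_good; easy|].
  rewrite E, !N in * by easy. unfold bessel_norm.
  apply Cx_eq; unfold RtoC; cbn [Re Im]; [rewrite H1; ring|rewrite H2].
  rewrite (bessel_sym n (fun t => Im (cauchy_kernel z t))). ring.
Qed.

(** Darboux formula at [z] and [Cconj z]: as [z - conj z = 2 i Im z] and
    [F conj E - E conj F = 2 i Im (F conj E)], the factor [2 i] cancels. *)
Lemma bessel_norm_kernel n z : Im z <> 0 ->
  Im z * bessel_norm n (cauchy_kernel z) =
  Im (Fn st P (weyl z) z n * Cconj (En st P (weyl z) z n))%Cx.
Proof.
  intros Hz. assert (Hz' : Im (Cconj z) <> 0) by (simpl; lra).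
  pose proof (darboux_bessel n z (Cconj z) Hz Hz') as H.
  rewrite cbessel_kernel_conj, weyl_conj, <- Cconj_En, <- Cconj_Fn in H by easy.
  apply (f_equal Im) in H. simpl in *. lra.
Qed.

(* Moving [z] changes the kernel by [(z - y) / ((t - z)(t - y))], which is
   [O(z - y)] in L^2 uniformly near [y]. *)
Lemma cbessel_kernel_lip y y' : Im y <> 0 -> Im y' <> 0 -> exists K, 0 <= K /\
  forall n z, Cn2 (z - y) < Im y * Im y / 4 ->
   Cn2 (cbessel n (cauchy_kernel z) (cauchy_kernel y')
        - cbessel n (cauchy_kernel y) (cauchy_kernel y')) <= K * Cn2 (z - y).
Proof.
  intros Hy Hy'. pose proof (Im_sqr_pos y Hy) as Py. pose proof (Im_sqr_pos y' Hy') as Py'.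
  set (V := mu (fun _ => 1)).
  assert (HV : 0 <= V) by (apply (pf_ge0 _ Hmu); [apply good_const|intros; lra]).
  set (a := / (Im y * Im y)). set (a' := / (Im y' * Im y')).
  assert (Ha : 0 < a) by (apply Rinv_0_lt_compat; easy).
  assert (Ha' : 0 < a') by (apply Rinv_0_lt_compat; easy).
  (* The outer 4 is from Cauchy-Schwarz; [4 * a] bounds the kernel at [z], [a] the one at [y], [a']
     the one at [y'], and each norm costs a mass [V]. *)
  exists (4 * (4 * a * a * V * (a' * V))). split.
  { repeat apply Rmult_le_pos; lra. }
  intros n z Hz.
  (* In the disc of radius [|Im y| / 2] around [y] one has [|Im z| >= |Im y| / 2], so [z] stays off
     the real axis. *)
  assert (Hzi : Im y * Im y / 4 <= Im z * Im z).
  { unfold Cn2, Csub, Cadd, Copp in Hz; cbn [Re Im] in Hz.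
    pose proof (Rle_0_sqr (Re z + - Re y)) as Q1. pose proof (Rle_0_sqr (2 * Im z - Im y)) as Q2.
    unfold Rsqr in Q1, Q2. lra. }
  assert (Hz0 : Im z <> 0) by (intros E; rewrite E in Hzi; lra).
  assert (Gd : cgood (fun t => C1 * cauchy_kernel z t + - C1 * cauchy_kernel y t)%Cx)
    by (apply cgood_lin; apply kernel_good; easy).
  replace (cbessel n (cauchy_kernel z) (cauchy_kernel y')
        - cbessel n (cauchy_kernel y) (cauchy_kernel y'))%Cx
    with (cbessel n (fun t => C1 * cauchy_kernel z t + - C1 * cauchy_kernel y t)%Cx
           (cauchy_kernel y'))
    by (rewrite cbessel_lin by (apply kernel_good; easy); ring).
  eapply Rle_trans; [apply cbessel_cauchy_schwarz; auto; apply kernel_good; easy|].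
  assert (M : forall u v, Cn2 (u * v) = Cn2 u * Cn2 v)
    by (intros; unfold Cn2; simpl; ring).
  assert (N1 : bessel_norm n (fun t => C1 * cauchy_kernel z t + - C1 * cauchy_kernel y t)%Cx
     <= Cn2 (z - y) * (4 * a * a) * V).
  { apply bessel_norm_le; [easy|]. intros t.
    replace (C1 * cauchy_kernel z t + - C1 * cauchy_kernel y t)%Cx
      with (cauchy_kernel z t - cauchy_kernel y t)%Cx by ring.
    rewrite kernel_resolvent by easy. rewrite !M.
    apply Rmult_le_compat_l; [apply Cn2_ge0|].
    apply Rmult_le_compat; try apply Cn2_ge0.
    - eapply Rle_trans; [apply kernel_Cn2_le; easy|].
      replace (4 * a) with (/ (Im y * Im y / 4)) by (unfold a; field; easy).
      apply Rinv_le_contravar; lra.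
    - apply kernel_Cn2_le; easy. }
  assert (N2 : bessel_norm n (cauchy_kernel y') <= a' * V).
  { apply bessel_norm_le; [apply kernel_good; easy|].
    intros t; apply kernel_Cn2_le; easy. }
  assert (0 <= bessel_norm n (cauchy_kernel y')).
  { unfold bessel_norm. pose proof (kernel_good y' Hy') as [G1 G2].
    pose proof (bessel_ge0 n _ G1). pose proof (bessel_ge0 n _ G2). lra. }
  assert (0 <= bessel_norm n (fun t => C1 * cauchy_kernel z t + - C1 * cauchy_kernel y t)%Cx).
  { unfold bessel_norm. destruct Gd as [G1 G2].
    pose proof (bessel_ge0 n _ G1). pose proof (bessel_ge0 n _ G2). lra. }
  pose proof (Rmult_le_compat _ _ _ _ H0 H N1 N2).
  replace (4 * (4 * a * a * V * (a' * V)) * Cn2 (z - y))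
    with (4 * ((Cn2 (z - y) * (4 * a * a) * V) * (a' * V))) by ring. lra.
Qed.

End Bessel.

(** * Complex limits *)

Definition Ccv (u : nat -> Cx) (l : Cx) : Prop :=
  Un_cv (fun n => Re (u n)) (Re l) /\ Un_cv (fun n => Im (u n)) (Im l).

Lemma Un_cv_const c : Un_cv (fun _ => c) c.
Proof. intros eps He. exists O. intros n _. rewrite Rdist_eq. easy. Qed.

Lemma Ccv_const c : Ccv (fun _ => c) c.
Proof. split; apply Un_cv_const. Qed.

Lemma Ccv_add u v a b : Ccv u a -> Ccv v b -> Ccv (fun n => u n + v n)%Cx (a + b)%Cx.
Proof. intros [U1 U2] [V1 V2]. split; simpl; apply CV_plus; auto. Qed.

Lemma Ccv_mul u v a b : Ccv u a -> Ccv v b -> Ccv (fun n => u n * v n)%Cx (a * b)%Cx.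
Proof.
  intros [U1 U2] [V1 V2]. split; simpl.
  - apply CV_minus; apply CV_mult; auto.
  - apply CV_plus; apply CV_mult; auto.
Qed.

Lemma Ccv_ext u v l : (forall n, u n = v n) -> Ccv u l -> Ccv v l.
Proof.
  intros H. replace v with u; [easy|]. extensionality n. apply H.
Qed.

Lemma Ccv_sub u v a b : Ccv u a -> Ccv v b -> Ccv (fun n => u n - v n)%Cx (a - b)%Cx.
Proof.
  intros HU HV. replace (a - b)%Cx with (a + - C1 * b)%Cx by ring.
  apply Ccv_ext with (fun n => u n + - C1 * v n)%Cx; [intros; ring|].
  apply Ccv_add; [easy|]. apply Ccv_mul; [apply Ccv_const|easy].
Qed.

Lemma Ccv_conj u a : Ccv u a -> Ccv (fun n => Cconj (u n)) (Cconj a).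
Proof. intros [U1 U2]. split; simpl; [easy|]. apply CV_opp; easy. Qed.

Lemma Ccv_unique u a b : Ccv u a -> Ccv u b -> a = b.
Proof. intros [A1 A2] [B1 B2]. apply Cx_eq; eapply UL_sequence; eauto. Qed.

Lemma Ccv_Cn2 u a : Ccv u a -> Un_cv (fun n => Cn2 (u n)) (Cn2 a).
Proof. intros [U1 U2]. unfold Cn2. apply CV_plus; apply CV_mult; auto. Qed.

Lemma Cn2_mul z w : Cn2 (z * w) = Cn2 z * Cn2 w.
Proof. unfold Cn2; simpl; ring. Qed.

Lemma Cn2_add z w : Cn2 (z + w) <= 2 * Cn2 z + 2 * Cn2 w.
Proof.
  unfold Cn2; simpl. pose proof (Rle_0_sqr (Re z - Re w)).
  pose proof (Rle_0_sqr (Im z - Im w)). unfold Rsqr in *. lra.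
Qed.

Lemma Cn2_sub_sym z w : Cn2 (z - w) = Cn2 (w - z).
Proof. unfold Cn2; simpl; ring. Qed.

Lemma Im_div z v : v <> C0 -> Im (z / v) = Im (z * Cconj v) / Cn2 v.
Proof.
  intros Hv. pose proof (Cn2_pos _ Hv). unfold Cn2 in *. simpl. field. lra.
Qed.

(* Squared moduli keep all the estimates free of square roots. *)
Definition lip_lim (f : Cx -> Cx) (y l : Cx) : Prop :=
  exists K d, 0 < d /\ 0 <= K /\
    forall z, z <> y -> Cn2 (z - y) < d -> Cn2 (f z - l) <= K * Cn2 (z - y).

Lemma lip_lim_const c y : lip_lim (fun _ => c) y c.
Proof.
  exists 0, 1. split; [lra|]. split; [lra|]. intros z _ _.
  unfold Cn2; simpl. apply Req_le; ring.
Qed.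

Lemma lip_lim_id c y : lip_lim (fun z => z - c)%Cx y (y - c)%Cx.
Proof.
  exists 1, 1. split; [lra|]. split; [lra|]. intros z _ _.
  replace (z - c - (y - c))%Cx with (z - y)%Cx by ring. lra.
Qed.

Lemma lip_lim_ext f g y l d : 0 < d ->
  (forall z, z <> y -> Cn2 (z - y) < d -> f z = g z) ->
  lip_lim f y l -> lip_lim g y l.
Proof.
  intros Hd H (K & e & He & HK & HL). exists K, (Rmin d e).
  split; [apply Rmin_glb_lt; easy|]. split; [easy|]. intros z Hz Hze.
  pose proof (Rmin_l d e). pose proof (Rmin_r d e).
  rewrite <- H by (auto; lra). apply HL; auto; lra.
Qed.

Lemma lip_lim_add f g y l m : lip_lim f y l -> lip_lim g y m ->
  lip_lim (fun z => f z + g z)%Cx y (l + m)%Cx.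
Proof.
  intros (K & d & Hd & HK & HF) (L & e & He & HL & HG).
  exists (2 * K + 2 * L), (Rmin d e).
  split; [apply Rmin_glb_lt; easy|]. split; [lra|]. intros z Hz Hze.
  pose proof (Rmin_l d e). pose proof (Rmin_r d e).
  specialize (HF z Hz ltac:(lra)). specialize (HG z Hz ltac:(lra)).
  replace (f z + g z - (l + m))%Cx with ((f z - l) + (g z - m))%Cx by ring.
  eapply Rle_trans; [apply Cn2_add|]. lra.
Qed.

Lemma lip_lim_mul f g y l m : lip_lim f y l -> lip_lim g y m ->
  lip_lim (fun z => f z * g z)%Cx y (l * m)%Cx.
Proof.
  intros (K & d & Hd & HK & HF) (L & e & He & HL & HG).
  pose proof (Cn2_ge0 l) as Pl. pose proof (Cn2_ge0 m) as Pm.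
  (* From [f g - l m = (f - l) g + l (g - m)] and the bound [Cn2 (g z) <= 2 L e + 2 Cn2 m] near
     [y]. *)
  exists (2 * (K * (2 * L * e + 2 * Cn2 m)) + 2 * (Cn2 l * L)), (Rmin d e).
  split; [apply Rmin_glb_lt; easy|].
  split.
  { assert (0 <= L * e) by nra. assert (0 <= K * (2 * L * e + 2 * Cn2 m)) by nra. nra. }
  intros z Hz Hze.
  pose proof (Rmin_l d e). pose proof (Rmin_r d e).
  specialize (HF z Hz ltac:(lra)). specialize (HG z Hz ltac:(lra)).
  replace (f z * g z - l * m)%Cx with ((f z - l) * g z + l * (g z - m))%Cx by ring.
  eapply Rle_trans; [apply Cn2_add|]. rewrite !Cn2_mul.
  assert (G : Cn2 (g z) <= 2 * L * e + 2 * Cn2 m).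
  { replace (g z) with ((g z - m) + m)%Cx by ring.
    eapply Rle_trans; [apply Cn2_add|]. nra. }
  pose proof (Cn2_ge0 (f z - l)). pose proof (Cn2_ge0 (g z)).
  pose proof (Cn2_ge0 (z - y)).
  assert (Cn2 (f z - l) * Cn2 (g z) <= (K * Cn2 (z - y)) * (2 * L * e + 2 * Cn2 m))
    by (apply Rmult_le_compat; lra).
  assert (Cn2 l * Cn2 (g z - m) <= Cn2 l * (L * Cn2 (z - y)))
    by (apply Rmult_le_compat_l; lra).
  lra.
Qed.

Lemma lip_lim_inv f y l : l <> C0 -> lip_lim f y l ->
  lip_lim (fun z => Cinv (f z)) y (Cinv l).
Proof.
  intros Hl (K & d & Hd & HK & HF). pose proof (Cn2_pos l Hl) as Pl.
  (* Within this squared radius [Cn2 (f z - l) <= Cn2 l / 4], which keeps [Cn2 (f z)] at least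
     [Cn2 l / 4]. *)
  set (e := Cn2 l / 4 / (K + 1)).
  assert (He : 0 < e) by (unfold e; repeat apply Rdiv_lt_0_compat; lra).
  assert (He' : e * (K + 1) = Cn2 l / 4) by (unfold e; field; lra).
  exists (K * (4 / (Cn2 l * Cn2 l))), (Rmin d e).
  assert (0 < 4 / (Cn2 l * Cn2 l)) by (apply Rdiv_lt_0_compat; nra).
  split; [apply Rmin_glb_lt; easy|]. split; [nra|]. intros z Hz Hze.
  pose proof (Rmin_l d e). pose proof (Rmin_r d e).
  specialize (HF z Hz ltac:(lra)). pose proof (Cn2_ge0 (z - y)).
  assert (Hf : Cn2 l / 4 <= Cn2 (f z)).
  { assert (Cn2 l <= 2 * Cn2 (f z) + 2 * Cn2 (f z - l)).
    { replace l with (f z + - C1 * (f z - l))%Cx at 1 by ring.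
      eapply Rle_trans; [apply Cn2_add|]. rewrite Cn2_mul.
      replace (Cn2 (- C1)) with 1 by (unfold Cn2; simpl; ring). lra. }
    nra. }
  assert (Hf0 : f z <> C0).
  { intros E0. rewrite E0 in Hf. unfold Cn2 at 2 in Hf. simpl in Hf. lra. }
  assert (E : Cn2 (Cinv (f z) - Cinv l) * (Cn2 (f z) * Cn2 l) = Cn2 (f z - l)).
  { rewrite <- !Cn2_mul, (Cn2_sub_sym (f z)). f_equal. field. easy. }
  assert (P : Cn2 (Cinv (f z) - Cinv l) * (Cn2 l / 4 * Cn2 l) <= K * Cn2 (z - y)).
  { apply Rle_trans with (Cn2 (f z - l)); [|easy]. rewrite <- E.
    apply Rmult_le_compat_l; [apply Cn2_ge0|]. apply Rmult_le_compat_r; lra. }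
  apply Rmult_le_reg_r with (Cn2 l / 4 * Cn2 l); [nra|].
  replace (K * (4 / (Cn2 l * Cn2 l)) * Cn2 (z - y) * (Cn2 l / 4 * Cn2 l))
    with (K * Cn2 (z - y)) by (field; lra). easy.
Qed.

Lemma lip_lim_Cnorm f y l : lip_lim f y l ->
  forall eps, 0 < eps -> exists delta, 0 < delta /\
    forall z, z <> y -> Cnorm (z - y) < delta -> Cnorm (f z - l) < eps.
Proof.
  intros (K & d & Hd & HK & HF) eps He.
  set (D := Rmin (Rmin 1 d) (eps / (K + 1))).
  assert (0 < eps / (K + 1)) by (apply Rdiv_lt_0_compat; lra).
  assert (HD : 0 < D /\ D <= 1 /\ D <= d /\ D <= eps / (K + 1))
    by (unfold D, Rmin; repeat destruct Rle_dec; lra).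
  destruct HD as (D0 & D1 & D2 & D3).
  assert (D4 : D * (K + 1) <= eps).
  { replace eps with (eps / (K + 1) * (K + 1)) by (field; lra).
    apply Rmult_le_compat_r; lra. }
  exists D. split; [easy|]. intros z Hz HzD.
  assert (S : Cn2 (z - y) < D * D).
  { pose proof (sqrt_pos (Cn2 (z - y))). unfold Cnorm in HzD.
    change (sqrt (Cn2 (z - y)) < D) in HzD.
    rewrite <- (sqrt_sqrt (Cn2 (z - y))) by apply Cn2_ge0.
    apply Rmult_le_0_lt_compat; lra. }
  pose proof (Cn2_ge0 (z - y)).
  specialize (HF z Hz ltac:(nra)).
  change (sqrt (Cn2 (f z - l)) < eps).
  rewrite <- (sqrt_square eps) by lra. apply sqrt_lt_1; [apply Cn2_ge0|nra|].
  apply Rle_lt_trans with (K * Cn2 (z - y)); [easy|].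
  apply Rle_lt_trans with (K * (D * D)); [apply Rmult_le_compat_l; lra|].
  assert (0 <= K * D) by nra.
  apply Rlt_le_trans with ((D * (K + 1)) * (D * (K + 1))).
  - replace ((D * (K + 1)) * (D * (K + 1)))
      with (K * (D * D) + (K * D) * (K * D) + K * (D * D) + D * D) by ring.
    assert (0 < D * D) by nra. nra.
  - apply Rmult_le_compat; nra.
Qed.

(** * Nevanlinna parametrization *)

Section Nevanlinna.

Variables (mu : (R -> R) -> R) (st : nat -> R) (P : nat -> nat -> R).
Hypothesis Hmu : positive_functional mu.
Hypothesis mu_moment : forall k, mu (fun x => x ^ k) = st k.
Hypothesis P_deg : forall k j, (k < j)%nat -> P k j = 0.
Hypothesis P_lead : forall k, 0 < P k k.
Hypothesis P_orth : forall k m,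
  rsum (S m) (fun i => P m i * Lam P (fun j => st (i + j)%nat) k) =
  if Nat.eqb k m then 1 else 0.
Variables (A B C D : Cx -> Cx).
Hypothesis HN : nevanlinna_matrix P (QC st P) A B C D.

Let w := weyl mu.
Let F (z : Cx) : Cx := (C z + w z * D z)%Cx.
Let E (z : Cx) : Cx := (A z + w z * B z)%Cx.
Let N (z y : Cx) : Cx := (F z * E y - E z * F y)%Cx.
Let ker n z y := cbessel mu P n (cauchy_kernel z) (cauchy_kernel y).

Lemma Fn_cv v z : Ccv (Fn st P v z) (C z + v * D z)%Cx.
Proof.
  destruct (HN z) as (_ & _ & HC & HD).
  replace (C z + v * D z)%Cx with (C1 + ((C z - C1) + v * D z))%Cx by ring.
  eapply Ccv_ext; [|apply Ccv_add; [apply Ccv_const|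
    apply Ccv_add; [exact HC|apply Ccv_mul; [apply Ccv_const|exact HD]]]].
  intros n. unfold Fn. cbv beta. f_equal. rewrite <- !csum_scal.
  transitivity (C1 * csum (S n) (fun k => z * (RtoC (pevalR (P k) k 0) * QC st P k z))
    + C1 * csum (S n) (fun k => v * (z * (RtoC (pevalR (P k) k 0) * pevalC (P k) k z))))%Cx;
    [ring|].
  rewrite <- csum_lin. apply csum_ext; intros k _. unfold PC. ring.
Qed.

Lemma En_cv v z : Ccv (En st P v z) (A z + v * B z)%Cx.
Proof.
  destruct (HN z) as (HA & HB & _ & _).
  replace (A z + v * B z)%Cx with (- v + (A z + v * (B z + C1)))%Cx by ring.
  eapply Ccv_ext; [|apply Ccv_add; [apply Ccv_const|
    apply Ccv_add; [exact HA|apply Ccv_mul; [apply Ccv_const|exact HB]]]].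
  intros n. unfold En. cbv beta. f_equal. rewrite <- !csum_scal.
  transitivity (C1 * csum (S n) (fun k => z * (QC st P k C0 * QC st P k z))
    + C1 * csum (S n) (fun k => v * (z * (QC st P k C0 * pevalC (P k) k z))))%Cx;
    [ring|].
  rewrite <- csum_lin. apply csum_ext; intros k _. unfold PC. ring.
Qed.

(** The Darboux identity with both points at [z] and parameters 1 and 0 has the value 1 for every
    partial sum already. *)
Lemma nevanlinna_det z : (A z * D z - B z * C z)%Cx = C1.
Proof.
  pose proof (Ccv_sub _ _ _ _ (Ccv_mul _ _ _ _ (Fn_cv C1 z) (En_cv C0 z))
    (Ccv_mul _ _ _ _ (En_cv C1 z) (Fn_cv C0 z))) as H.
  apply (Ccv_ext _ (fun _ => C1)) in H.
  - rewrite (Ccv_unique _ _ _ (Ccv_const C1) H). ring.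
  - intros n. rewrite (darboux st P P_deg P_lead P_orth). ring.
Qed.

Lemma F_E_not_both z : F z = C0 -> E z = C0 -> False.
Proof.
  intros HF HE. apply C1_neq_C0. rewrite <- (nevanlinna_det z).
  transitivity (D z * E z - B z * F z)%Cx; [unfold E, F; ring|].
  rewrite HF, HE. ring.
Qed.

Lemma F_conj z : Im z <> 0 -> F (Cconj z) = Cconj (F z).
Proof.
  intros Hz. apply Ccv_unique with (Fn st P (w (Cconj z)) (Cconj z)); [apply Fn_cv|].
  apply Ccv_ext with (fun n => Cconj (Fn st P (w z) z n)).
  - intros n. rewrite Cconj_Fn. unfold w. rewrite (weyl_conj mu Hmu) by easy. easy.
  - apply Ccv_conj, Fn_cv.
Qed.

Lemma E_conj z : Im z <> 0 -> E (Cconj z) = Cconj (E z).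
Proof.
  intros Hz. apply Ccv_unique with (En st P (w (Cconj z)) (Cconj z)); [apply En_cv|].
  apply Ccv_ext with (fun n => Cconj (En st P (w z) z n)).
  - intros n. rewrite Cconj_En. unfold w. rewrite (weyl_conj mu Hmu) by easy. easy.
  - apply Ccv_conj, En_cv.
Qed.

Lemma ker_cv z y : Im z <> 0 -> Im y <> 0 ->
  Ccv (fun n => (z - y) * ker n z y)%Cx (N z y).
Proof.
  intros Hz Hy. eapply Ccv_ext.
  - intros n. symmetry. apply (darboux_bessel mu st P); auto.
  - apply Ccv_sub; apply Ccv_mul; apply Fn_cv || apply En_cv.
Qed.

(** Closed form of the limit of the Bessel norms: the squared distance, in the norm of [mu], of the
    Cauchy kernel at [z] from the polynomials. *)
Definition gap (z : Cx) : R := Im (F z * Cconj (E z)) / Im z.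

Lemma gap_cv z : Im z <> 0 ->
  Un_cv (fun n => bessel_norm mu P n (cauchy_kernel z)) (gap z).
Proof.
  intros Hz.
  apply Un_cv_ext with (fun n => Im (Fn st P (w z) z n * Cconj (En st P (w z) z n)) * / Im z).
  - intros n. unfold w. rewrite <- (bessel_norm_kernel mu st P) by auto. field. easy.
  - unfold gap, Rdiv. apply CV_mult; [|apply Un_cv_const].
    apply Ccv_mul; [apply Fn_cv|]. apply Ccv_conj, En_cv.
Qed.

Lemma gap_ge0 z : Im z <> 0 -> 0 <= gap z.
Proof.
  intros Hz. apply (@Rle_cv_lim (fun n => 0) (fun n => bessel_norm mu P n (cauchy_kernel z)));
    [|apply Un_cv_const|apply gap_cv; easy].
  intros n. destruct (kernel_good z Hz) as [G1 G2]. unfold bessel_norm.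
  pose proof (bessel_ge0 mu st P Hmu mu_moment P_orth n _ G1).
  pose proof (bessel_ge0 mu st P Hmu mu_moment P_orth n _ G2). lra.
Qed.

(** Cauchy-Schwarz in the limit: a single zero [y] of [gap] forces [N z y = 0] for all nonreal
    [z]. *)
Lemma N_bound z y : Im z <> 0 -> Im y <> 0 ->
  Cn2 (N z y) <= Cn2 (z - y) * (4 * (gap z * gap y)).
Proof.
  intros Hz Hy.
  apply (@Rle_cv_lim (fun n => Cn2 ((z - y) * ker n z y))
   (fun n => Cn2 (z - y) * (4 * (bessel_norm mu P n (cauchy_kernel z)
      * bessel_norm mu P n (cauchy_kernel y))))).
  - intros n. rewrite Cn2_mul. apply Rmult_le_compat_l; [apply Cn2_ge0|].
    apply (cbessel_cauchy_schwarz mu st P); auto; apply kernel_good; easy.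
  - apply Ccv_Cn2, ker_cv; easy.
  - repeat (apply CV_mult; try apply Un_cv_const); apply gap_cv; easy.
Qed.

(** [b] is the limit of the Bessel forms and so exists for [y' = y] too, where it fills the
    removable singularity of the quotient. The condition on [z] keeps the denominator nonzero; it is
    met for [y' = y] and for [y' = Cconj y]. *)
Lemma N_quotient_lip y y' : Im y <> 0 -> Im y' <> 0 -> exists b,
  ((y - y') * b)%Cx = N y y' /\
  ((forall z, Cn2 (z - y) < Im y * Im y / 4 -> z <> y -> z <> y') ->
   lip_lim (fun z => N z y' / (z - y'))%Cx y b).
Proof.
  intros Hy Hy'.
  destruct (cbessel_cv mu st P Hmu mu_moment P_orth (cauchy_kernel y) (cauchy_kernel y'))
    as [b Hb]; try (apply kernel_good; easy).
  change (Ccv (fun n => ker n y y') b) in Hb. exists b. split.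
  { eapply Ccv_unique; [|apply ker_cv; auto]. apply Ccv_mul; [apply Ccv_const|easy]. }
  intros Hne.
  destruct (cbessel_kernel_lip mu st P Hmu mu_moment P_orth y y' Hy Hy') as (K & HK & HL).
  pose proof (Im_sqr_pos y Hy).
  exists K, (Im y * Im y / 4). split; [lra|]. split; [easy|].
  intros z Hzy Hz. specialize (Hne z Hz Hzy).
  assert (Hd : (z - y')%Cx <> C0) by (intros E0; apply Hne, Csub_eq0; easy).
  assert (Hzi : Im z <> 0).
  { intros E0. unfold Cn2, Csub, Cadd, Copp in Hz; cbn [Re Im] in Hz. rewrite E0 in Hz.
    pose proof (Rle_0_sqr (Re z + - Re y)) as Q. unfold Rsqr in Q. lra. }
  apply (@Rle_cv_lim (fun n => Cn2 (ker n z y' - ker n y y')) (fun n => K * Cn2 (z - y)));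
    [intros n; apply HL; easy| |apply Un_cv_const].
  apply Ccv_Cn2, Ccv_sub; [|easy].
  apply Ccv_ext with (fun n => ((z - y') * ker n z y') * Cinv (z - y'))%Cx;
    [intros; field; easy|].
  apply Ccv_mul; [apply ker_cv; auto|apply Ccv_const].
Qed.

(** Cramer's rule: [E y * N z (conj y) - conj (E y) * N z y = E z * N y (conj y)]. The last factor
    is [2 i Im (F y conj (E y))], nonzero because [gap y > 0], so [E] inherits the Lipschitz bounds
    of [N]. *)
Lemma E_lip y : 0 < Im y -> 0 < gap y -> lip_lim E y (E y).
Proof.
  intros Hy Hg. assert (Hy0 : Im y <> 0) by lra.
  assert (Hc0 : Im (Cconj y) <> 0) by (simpl; lra).
  pose proof (Im_sqr_pos y Hy0).
  (* [Cconj y] is at distance [2 Im y] from [y], outside the disc of radius [Im y / 2]. *)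
  assert (Hcl : forall z, Cn2 (z - y) < Im y * Im y / 4 -> z <> Cconj y).
  { intros z Hz ->. unfold Cn2 in Hz; simpl in Hz. lra. }
  assert (Hne : forall z w : Cx, z <> w -> (z - w)%Cx <> C0)
    by (intros z v H0 E0; apply H0, Csub_eq0; easy).
  destruct (N_quotient_lip y y Hy0 Hy0) as (b1 & _ & L1); specialize (L1 ltac:(auto)).
  destruct (N_quotient_lip y (Cconj y) Hy0 Hc0) as (b2 & E2 & L2); specialize (L2 ltac:(auto)).
  assert (EN : N y (Cconj y) = (F y * Cconj (E y) - E y * Cconj (F y))%Cx)
    by (unfold N; rewrite F_conj, E_conj; easy).
  assert (Hden : N y (Cconj y) <> C0).
  { rewrite EN. intros H0. apply (f_equal Im) in H0. unfold gap in Hg.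
    assert (0 < Im (F y * Cconj (E y)) / Im y * Im y) by (apply Rmult_lt_0_compat; lra).
    replace (Im (F y * Cconj (E y)) / Im y * Im y) with (Im (F y * Cconj (E y))) in H1
      by (field; lra).
    simpl in H0, H1. lra. }
  (* Each [N] is written as a linear factor times its quotient, to which [L1] and [L2] apply. *)
  assert (L : lip_lim (fun z => (E y * ((z - Cconj y) * (N z (Cconj y) / (z - Cconj y)))
      + (- Cconj (E y)) * ((z - y) * (N z y / (z - y)))) * Cinv (N y (Cconj y)))%Cx y
      ((E y * ((y - Cconj y) * b2) + (- Cconj (E y)) * ((y - y) * b1)) * Cinv (N y (Cconj y)))%Cx).
  { apply lip_lim_mul; [|apply lip_lim_const].
    apply lip_lim_add; (apply lip_lim_mul; [apply lip_lim_const|]);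
    (apply lip_lim_mul; [apply lip_lim_id|easy]). }
  replace ((E y * ((y - Cconj y) * b2) + (- Cconj (E y)) * ((y - y) * b1)) * Cinv (N y (Cconj y)))%Cx
    with (E y) in L.
  - revert L. apply (lip_lim_ext _ _ _ _ (Im y * Im y / 4)); [lra|].
    intros z Hz Hzd. pose proof (Hne _ _ Hz). pose proof (Hne _ _ (Hcl z Hzd)).
    transitivity ((E y * N z (Cconj y) - Cconj (E y) * N z y) / N y (Cconj y))%Cx;
      [field; auto|].
    rewrite EN in Hden |- *. unfold N at 1 2. rewrite F_conj, E_conj by easy.
    field. exact Hden.
  - rewrite E2. field. easy.
Qed.

Lemma phi_holomorphic : (forall y, 0 < Im y -> 0 < gap y) ->
  (forall y, 0 < Im y -> E y <> C0) ->
  holomorphic_upper (fun z => F z / E z)%Cx.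
Proof.
  intros Hg HE y Hy. unfold upper in Hy. assert (Hy0 : Im y <> 0) by lra.
  pose proof (Im_sqr_pos y Hy0).
  destruct (N_quotient_lip y y Hy0 Hy0) as (b & _ & L); specialize (L ltac:(auto)).
  (* The limit of [N z y / ((z - y) * (E z * E y))], the difference quotient of [F / E]. *)
  exists (b * Cinv (E y * E y))%Cx.
  assert (LE : lip_lim (fun z => (N z y / (z - y)) * Cinv (E z * E y))%Cx y
     (b * Cinv (E y * E y))%Cx).
  { apply lip_lim_mul; [easy|]. apply lip_lim_inv.
    - intros H0. destruct (Cmul_integral _ _ H0); apply (HE y Hy); easy.
    - apply lip_lim_mul; [apply E_lip; auto|apply lip_lim_const]. }
  apply (lip_lim_ext _ (fun z => (F z / E z - F y / E y) / (z - y))%Cx _ _ (Im y * Im y / 4)) in LE;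
    [|lra|].
  - intros eps He. destruct (lip_lim_Cnorm _ _ _ LE eps He) as (delta & Hd & HL).
    exists delta. split; [easy|]. intros h Hh Hhd.
    assert (Eh : (y + h - y)%Cx = h) by ring.
    specialize (HL (y + h)%Cx). rewrite Eh in HL. apply HL; [|easy].
    intros H0. apply Hh. rewrite <- Eh, H0. ring.
  - intros z Hz Hzd.
    assert (Hzi : 0 < Im z).
    { unfold Cn2, Csub, Cadd, Copp in Hzd; cbn [Re Im] in Hzd.
      pose proof (Rle_0_sqr (Re z + - Re y)) as Q. unfold Rsqr in Q.
      apply Rnot_le_lt. intros Hn. nra. }
    unfold N. field. repeat split; auto.
    intros H0; apply Hz, Csub_eq0; easy.
Qed.

(** Since the determinant is 1, [A F - C E = w] and [B F - D E = -1]. *)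
Lemma nev_transform_weyl z f : E z <> C0 -> f z = (F z / E z)%Cx ->
  nev_transform A B C D (Some f) z = w z.
Proof.
  intros HE Hf. unfold nev_transform. rewrite Hf.
  pose proof (nevanlinna_det z) as Hdet.
  assert (H1 : (A z * (F z / E z) - C z = w z / E z)%Cx).
  { transitivity (w z * (A z * D z - B z * C z) / E z)%Cx; [|rewrite Hdet; field; easy].
    transitivity ((A z * F z - C z * E z) / E z)%Cx; [field; easy|].
    f_equal. unfold F, E. ring. }
  assert (H2 : (B z * (F z / E z) - D z = - C1 / E z)%Cx).
  { transitivity (- (A z * D z - B z * C z) / E z)%Cx; [|rewrite Hdet; easy].
    transitivity ((B z * F z - D z * E z) / E z)%Cx; [field; easy|].
    f_equal. unfold F, E. ring. }
  rewrite H1, H2. field. split; [easy|].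
  intros H0. apply (f_equal Re) in H0. simpl in H0. lra.
Qed.

Theorem nevanlinna_parametrization : exists phi, in_N phi /\
  forall z, 0 < Im z -> nev_transform A B C D phi z = weyl mu z.
Proof.
  destruct (excluded_middle_informative (exists y, 0 < Im y /\ gap y = 0)) as [(y & Hy & Hg)|Hg].
  - assert (H0 : forall z, 0 < Im z -> (F z * E y = E z * F y)%Cx).
    { intros z Hz. apply Csub_eq0, Cn2_eq0, Rle_antisym; [|apply Cn2_ge0].
      eapply Rle_trans; [apply N_bound; lra|]. rewrite Hg. apply Req_le; ring. }
    (* [H0] makes [(F z, E z)] parallel to [(F y, E y)], and neither vector is 0; hence [E] vanishes
       everywhere or nowhere in the upper half-plane. *)
    destruct (excluded_middle_informative (E y = C0)) as [HE|HE].
    + exists None. split; [easy|]. intros z Hz.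
      assert (Ez : E z = C0).
      { specialize (H0 z Hz). rewrite HE in H0.
        destruct (Cmul_integral (E z) (F y)) as [|HF]; [rewrite <- H0; ring|easy|].
        exfalso. apply (F_E_not_both y); easy. }
      (* With [E z = 0], a zero of [B z] would make [A z] vanish too, against determinant 1. *)
      assert (HB : B z <> C0).
      { intros HB. apply C1_neq_C0. rewrite <- (nevanlinna_det z), HB.
        replace (A z) with (E z - w z * B z)%Cx by (unfold E; ring). rewrite Ez, HB. ring. }
      simpl. change (weyl mu z) with (w z).
      replace (A z) with (E z - w z * B z)%Cx by (unfold E; ring). rewrite Ez. field. easy.
    + exists (Some (fun _ => F y / E y)%Cx). split.
      * split.
        { intros z _. exists C0. intros eps He. exists 1. split; [lra|]. intros h Hh _.
          replace (Cnorm _) with 0; [easy|]. unfold Cnorm. rewrite <- sqrt_0. f_equal.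
          replace ((F y / E y - F y / E y) / h - C0)%Cx with C0 by (field; auto).
          simpl. ring. }
        intros z _. unfold gap in Hg.
        assert (Hi : Im (F y * Cconj (E y)) = 0).
        { replace (Im (F y * Cconj (E y))) with (Im (F y * Cconj (E y)) / Im y * Im y)
            by (field; lra). rewrite Hg. ring. }
        rewrite (Im_div _ _ HE), Hi. unfold Rdiv. lra.
      * intros z Hz. specialize (H0 z Hz).
        assert (Ez : E z <> C0).
        { intros Ez. apply (F_E_not_both z); [|easy]. rewrite Ez in H0.
          destruct (Cmul_integral (F z) (E y)); [rewrite H0; ring|easy|easy]. }
        apply nev_transform_weyl; [easy|].
        transitivity (F z * E y / (E z * E y))%Cx; [rewrite H0; field|field]; auto.
  - assert (Hp : forall y, 0 < Im y -> 0 < gap y).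
    { intros y Hy. destruct (gap_ge0 y ltac:(lra)) as [|E0]; [easy|].
      exfalso; apply Hg. exists y; auto. }
    assert (HE : forall y, 0 < Im y -> E y <> C0).
    { intros y Hy E0. specialize (Hp y Hy). unfold gap in Hp. rewrite E0 in Hp.
      replace (Im (F y * Cconj C0)) with 0 in Hp by (simpl; ring).
      unfold Rdiv in Hp. rewrite Rmult_0_l in Hp. lra. }
    exists (Some (fun z => F z / E z)%Cx). split.
    + split; [apply phi_holomorphic; auto|]. intros z Hz. unfold upper in Hz.
      pose proof (Cn2_pos _ (HE z Hz)) as HpE. specialize (Hp z Hz). unfold gap in Hp.
      rewrite Im_div by auto.
      replace (Im (F z * Cconj (E z))) with (Im (F z * Cconj (E z)) / Im z * Im z)
        by (field; lra).
      left. apply Rdiv_lt_0_compat; [|easy]. apply Rmult_lt_0_compat; lra.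
    + intros z Hz. apply nev_transform_weyl; auto.
Qed.

End Nevanlinna.

(** * From the given data to moments, and conclusion *)

(** The integrand is a polynomial in [x], so [Q] depends on [sigt] only through its moments, which
    [mu] shares. *)
Lemma second_kind_eq st sigt P Q : moment_solution st sigt -> second_kind sigt P Q ->
  forall k z, Q k z = QC st P k z.
Proof.
  intros Hm HQ k z. destruct (HQ k z) as [H1 H2].
  pose proof (stieltjes_positive st sigt Hm) as Hpos.
  pose proof (stieltjes_moment st sigt Hm) as Hmom.
  assert (S : forall c : Cx -> R, (c = Re \/ c = Im) ->
     stieltjes sigt (fun x => c (divdiff (P k) k z x)) = c (QC st P k z)).
  { intros c Hc.
    assert (Csum : forall n u, c (csum n u) = rsum n (fun i => c (u i)))
      by (destruct Hc; subst; auto using Re_csum, Im_csum).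
    assert (Cl : forall a u, c (RtoC a * u)%Cx = a * c u)
      by (destruct Hc; subst; intros; simpl; ring).
    assert (Cr : forall a u, c (u * RtoC a)%Cx = c u * a)
      by (destruct Hc; subst; intros; simpl; ring).
    transitivity (stieltjes sigt (fun x => rsum (S k) (fun j => P k j *
      rsum j (fun i => c (Cpow z i) * x ^ (j - 1 - i))))).
    - apply functional_ext; intros x. unfold divdiff. rewrite Csum.
      apply rsum_ext; intros j _. rewrite Cl, Csum. f_equal.
      apply rsum_ext; intros i _. apply Cr.
    - rewrite (pf_rsum _ Hpos (S k) (P k)
        (fun j x => rsum j (fun i => c (Cpow z i) * x ^ (j - 1 - i)))).
      + unfold QC, cLam. rewrite Csum. apply rsum_ext; intros j _. rewrite Cl. f_equal.
        rewrite (pf_rsum _ Hpos j (fun i => c (Cpow z i)) (fun i x => x ^ (j - 1 - i)))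
          by (intros; apply good_pow).
        unfold qmom. rewrite Csum. apply rsum_ext; intros i _. rewrite Cr, Hmom. easy.
      + intros j. apply (good_rsum j (fun i x => c (Cpow z i) * x ^ (j - 1 - i))).
        intros i. apply good_scal, good_pow. }
  apply Cx_eq.
  - rewrite <- (stieltjes_eq _ _ _ H1). apply (S Re); auto.
  - rewrite <- (stieltjes_eq _ _ _ H2). apply (S Im); auto.
Qed.

Theorem mainTheorem9 :
  forall (s : nat -> R) (d l0 : nat) (sigma : R -> R),
    positive_seq s ->
    (1 <= d)%nat ->
    Nat.even l0 = true ->
    moment_solution s sigma ->
    indeterminate (fun k => s (k * d + l0)%nat) ->
    forall (sigt : R -> R) (P : nat -> nat -> R) (Q : nat -> Cx -> Cx)
           (A B C D : Cx -> Cx),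
      moment_solution (fun k => s (k * d + l0)%nat) sigt ->
      orthonormal_polys sigt P ->
      second_kind sigt P Q ->
      nevanlinna_matrix P Q A B C D ->
      exists phi : option (Cx -> Cx),
        in_N phi /\
        forall lam : Cx, 0 < Im lam ->
          CRS_int_R (fun x => Cdiv (RtoC (x ^ l0)) (Csub (RtoC (x ^ d)) lam))
                    sigma (nev_transform A B C D phi lam).
Proof.
  intros s d l0 sigma _ Hd Hl Hs _ sigt P Q A B C D Ht (P_deg & P_lead & P_orth) HQ HN.
  set (st := fun k => s (k * d + l0)%nat) in *.
  set (mu := fun f => stieltjes sigma (fun x => x ^ l0 * f (x ^ d))).
  pose proof (second_kind_eq st sigt P Q Ht HQ) as EQ.
  replace Q with (QC st P) in HN
    by (extensionality k; extensionality z; symmetry; apply EQ).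
  assert (Orth : forall k m, rsum (S m) (fun i => P m i * Lam P (fun j => st (i + j)%nat) k)
    = if Nat.eqb k m then 1 else 0).
  { intros k m. rewrite Nat.eqb_sym, <- (stieltjes_eq _ _ _ (P_orth m k)). symmetry.
    apply (pf_pevalR_pevalR _ (stieltjes_positive st sigt Ht) st).
    apply (stieltjes_moment st sigt Ht). }
  destruct (nevanlinna_parametrization mu st P
    (pullback_positive s sigma Hs d l0 Hd Hl)
    (pullback_moment s sigma Hs d l0) P_deg P_lead Orth A B C D HN) as (phi & Hphi & Hw).
  exists phi. split; [easy|]. intros lam Hlam. rewrite Hw by easy.
  assert (Hlam0 : Im lam <> 0) by lra.
  (* The integrand [x^l0 / (x^d - lam)] is the pullback of the Cauchy kernel, so its integral exists
     and is [weyl mu lam] by the definition of [mu]. *)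
  destruct (kernel_good lam Hlam0) as [G1 G2]. split.
  - eapply RS_int_R_ext; [|apply (stieltjes_spec s sigma Hs), (good_pullback _ d l0 Hd G1)].
    intros x. unfold Cdiv, cauchy_kernel. simpl. ring.
  - eapply RS_int_R_ext; [|apply (stieltjes_spec s sigma Hs), (good_pullback _ d l0 Hd G2)].
    intros x. unfold Cdiv, cauchy_kernel. simpl. ring.
Qed.
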